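(* Let $m\ge 1$ be an integer and let $p$ be a real number with $p>m$. There is a constant $C$, depending only on $m$ and $p$, such that for every smooth real-valued function $\varphi$ with compact support on $\mathbb{H}^m$ and every $\lambda>0$ there exists a decomposition $\varphi=\varphi_1+\varphi_2$ on $\mathbb{H}^m$ such that $\varphi_2$ is smooth with compact support on $\mathbb{H}^m$, $$\|\varphi_1\|_{L^\infty(\mathbb{H}^m)}\le C\lambda^{1-\frac{m}{p}}\|\nabla_g\varphi\|_{L^p(\mathbb{H}^m)}$$ and $$\|\nabla_g\varphi_2\|_{L^\infty(\mathbb{H}^m)}\le C\lambda^{-\frac{m}{p}}\|\nabla_g\varphi\|_{L^p(\mathbb{H}^m)}.$$
   Context: $\mathbb{H}^m$ is the upper half space $\{x=(x',x_m)\in\mathbb{R}^{m-1}\times\mathbb{R}: x_m>0\}$ with the Riemannian metric $g=|dx|^2/x_m^2$ and volume measure $dV_g=dx/x_m^m$. $\nabla_g\varphi$ is the gradient of the function $\varphi$ with respect to $g$, measured in the norm $|\cdot|_g$ (so $|\nabla_g\varphi|_g=x_m|\nabla_e\varphi|$, where $\nabla_e$ is the Euclidean gradient and $|\cdot|$ the Euclidean norm). $L^p(\mathbb{H}^m)$ norms are taken with respect to $dV_g$. *)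

(* Defs.v *)
(* MathComp-Analysis *)
From HB Require Import structures.
From mathcomp Require Import all_boot all_order all_algebra.
From mathcomp Require Import all_classical all_reals all_analysis.
From mathcomp Require Import measurable_realfun ess_sup_inf.

Set Implicit Arguments.
Unset Strict Implicit.
Unset Printing Implicit Defensive.

Import Order.TTheory GRing.Theory Num.Theory.
Import numFieldNormedType.Exports.

Local Open Scope classical_set_scope.
Local Open Scope ring_scope.

Definition measure_matrix_display : measure_display -> measure_display.
Proof. exact. Qed.

Section measurable_matrix.
Context {d : measure_display} {T : measurableType d}.
Variables m n : nat.

(* The product sigma-algebra, generated by the coordinate maps. *)
Definition matrix_measurable : set (set 'M[T]_(m, n)) :=
  <<s \bigcup_(ij in [set: 'I_m * 'I_n])
        preimage_set_system setT (fun A : 'M[T]_(m, n) => A ij.1 ij.2)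
          measurable >>.

Let matrix_set0 : matrix_measurable set0.
Proof. exact: sigma_algebra0. Qed.

Let matrix_setC A : matrix_measurable A -> matrix_measurable (~` A).
Proof. exact: sigma_algebraC. Qed.

Let matrix_bigcup (F : (set 'M[T]_(m, n))^nat) :
  (forall i, matrix_measurable (F i)) -> matrix_measurable (\bigcup_i F i).
Proof. exact: sigma_algebra_bigcup. Qed.

HB.instance Definition _ := @isMeasurable.Build (measure_matrix_display d)
  'M[T]_(m, n) matrix_measurable matrix_set0 matrix_setC matrix_bigcup.

Lemma measurable_coord (i : 'I_m) (j : 'I_n) :
  measurable_fun [set: 'M[T]_(m, n)] (fun A : 'M[T]_(m, n) => A i j).
Proof.
move=> _ Y mY; apply: sub_sigma_algebra.
by exists (i, j) => //; exists Y.
Qed.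

Lemma measurable_fun_matrixP d' (S : measurableType d')
    (f : S -> 'M[T]_(m, n)) :
  (forall i j, measurable_fun setT (fun x => f x i j)) -> measurable_fun setT f.
Proof.
move=> mf; apply: (@measurability _ _ _ _ _ _
  (\bigcup_(ij in [set: 'I_m * 'I_n])
        preimage_set_system setT (fun A : 'M[T]_(m, n) => A ij.1 ij.2)
          measurable)) => //.
move=> _ [_ [[i j] _ [B mB <-]] <-]; rewrite setTI.
by have := mf i j measurableT _ mB; rewrite !setTI.
Qed.

End measurable_matrix.

Section lebesgue_rV.
Variable R : realType.
Local Open Scope ereal_scope.

Definition rV_cons n (u : measurableTypeR R * 'rV[R]_n) : 'rV[R]_n.+1 :=
  \row_i oapp (u.2 ord0) u.1 (unlift ord0 i).

Definition rV_uncons n (A : 'rV[R]_n.+1) : measurableTypeR R * 'rV[R]_n :=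
  (A ord0 ord0, \row_i A ord0 (lift ord0 i)).

Lemma rV_cons0 n u : @rV_cons n u ord0 ord0 = u.1.
Proof. by rewrite mxE unlift_none. Qed.

Lemma rV_consS n u i : @rV_cons n u ord0 (lift ord0 i) = u.2 ord0 i.
Proof. by rewrite mxE liftK. Qed.

Lemma rV_consK n : cancel (@rV_cons n) (@rV_uncons n).
Proof.
move=> [x v]; rewrite /rV_uncons rV_cons0; congr pair.
by apply/rowP => i; rewrite mxE rV_consS.
Qed.

Lemma measurable_rV_cons n : measurable_fun setT (@rV_cons n).
Proof.
apply: measurable_fun_matrixP => i j; rewrite (ord1 i).
case: (unliftP ord0 j) => [k|] ->; last first.
  by rewrite (_ : (fun _ => _) = fst); first exact: measurable_fst; apply/funext => x; rewrite rV_cons0.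
rewrite (_ : (fun _ => _) = (fun A : 'rV[R]_n => A ord0 k) \o snd).
  by apply: measurableT_comp => //; exact: measurable_coord.
by apply/funext => x; rewrite rV_consS.
Qed.

Lemma measurable_rV_uncons n : measurable_fun setT (@rV_uncons n).
Proof.
apply/measurable_fun_pair; first exact: measurable_coord.
apply: measurable_fun_matrixP => i j.
rewrite (_ : (fun _ => _) = fun A : 'rV[R]_n.+1 => A ord0 (lift ord0 j)).
  exact: measurable_coord.
by apply/funext => A; rewrite mxE.
Qed.

Section step.
Variables (n : nat) (mu : {sigma_finite_measure set 'rV[R]_n -> \bar R}).

Definition lebesgue_rVS : set 'rV[R]_n.+1 -> \bar R :=
  pushforward (@lebesgue_measure R \x mu) (@rV_cons n).

Let lebesgue_rVS0 : lebesgue_rVS set0 = 0.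
Proof. by rewrite /lebesgue_rVS /pushforward preimage_set0 measure0. Qed.

Let lebesgue_rVS_ge0 A : 0 <= lebesgue_rVS A.
Proof. by rewrite /lebesgue_rVS /pushforward measure_ge0. Qed.

Let lebesgue_rVS_sigma_additive : semi_sigma_additive lebesgue_rVS.
Proof.
move=> F mF tF mUF; rewrite /lebesgue_rVS /pushforward preimage_bigcup.
have mpre A : measurable A -> measurable (@rV_cons n @^-1` A).
  by move=> mA; rewrite -[X in measurable X]setTI; exact: measurable_rV_cons.
apply: measure_semi_sigma_additive.
- by move=> k; exact: mpre.
- apply/trivIsetP => /= i j _ _ ij; rewrite -preimage_setI.
  by move/trivIsetP : tF => /(_ _ _ _ _ ij) ->//; rewrite preimage_set0.
- by rewrite -preimage_bigcup; exact: mpre.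
Qed.

HB.instance Definition _ := isMeasure.Build _ _ _ lebesgue_rVS
  lebesgue_rVS0 lebesgue_rVS_ge0 lebesgue_rVS_sigma_additive.

Let lebesgue_rVS_sigma_finite : sigma_finite setT lebesgue_rVS.
Proof.
have /sigma_finiteP[F [TF ndF Foo]] := sigma_finiteT (@lebesgue_measure R).
have /sigma_finiteP[G [TG ndG Goo]] := sigma_finiteT mu.
exists (fun k => @rV_uncons n @^-1` (F k `*` G k)).
  rewrite -preimage_bigcup; apply/seteqP; split => // A _.
  have [i _ Fi] : (\bigcup_k F k) (rV_uncons A).1 by rewrite -TF.
  have [j _ Gj] : (\bigcup_k G k) (rV_uncons A).2 by rewrite -TG.
  exists (maxn i j) => //; split.
  - by move: Fi; exact/subsetPset/ndF/leq_maxl.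
  - by move: Gj; exact/subsetPset/ndG/leq_maxr.
move=> k; have [mF Fk] := Foo k; have [mG Gk] := Goo k; split.
  rewrite -[X in measurable X]setTI; apply: measurable_rV_uncons => //.
  exact: measurableX.
rewrite /lebesgue_rVS /pushforward -comp_preimage.
rewrite (_ : @rV_uncons n \o _ = id); last exact/funext/rV_consK.
by rewrite preimage_id product_measure1E// lte_mul_pinfty// ge0_fin_numE.
Qed.

HB.instance Definition _ := Measure_isSigmaFinite.Build _ _ _ lebesgue_rVS
  lebesgue_rVS_sigma_finite.

End step.

Fixpoint lebesgue_rV n : {sigma_finite_measure set 'rV[R]_n -> \bar R} :=
  if n is k.+1 then lebesgue_rVS (lebesgue_rV k) else \d_(0%R : 'rV[R]_0).

Lemma lebesgue_rV_box n (A : 'I_n -> set R) : (forall i, measurable (A i)) ->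
  lebesgue_rV n [set x : 'rV[R]_n | forall i, A i (x ord0 i)] =
  \prod_(i < n) lebesgue_measure (A i).
Proof.
elim: n A => [|n IH] A mA.
  by rewrite big_ord0 /= diracE mem_set// => -[].
rewrite big_ord_recl /= /lebesgue_rVS /pushforward -IH//.
rewrite -product_measure1E//; last first.
  rewrite (_ : [set _ | _] = \bigcap_(i in [set: 'I_n])
    ((fun x : 'rV[R]_n => x ord0 i) @^-1` A (lift ord0 i))); last first.
    by apply/seteqP; split => x /= h i // *; exact: h.
  apply: fin_bigcap_measurable => // i _.
  by rewrite -[X in measurable X]setTI; exact: measurable_coord.
  exact: (mA ord0).
congr (product_measure1 _ _ _); apply/seteqP; split => -[x v] /= h.
- split => [|i]; first by have := h ord0; rewrite rV_cons0.
  by have := h (lift ord0 i); rewrite rV_consS.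
- move=> i; case: (unliftP ord0 i) => [k|] ->; last by rewrite rV_cons0; exact: h.1.
  by rewrite rV_consS; exact: h.2.
Qed.

End lebesgue_rV.

Section half_space.
Variables (R : realType) (n : nat).
Local Notation m := n.+1.
Implicit Types (x u v : 'rV[R]_m) (f : 'rV[R]_m -> R).

(* H^m for m = n.+1, as a subset of 'rV_m. *)
Definition height x : R := x 0 ord_max.
Definition half_space : set 'rV[R]_m := [set x | 0 < height x].

Lemma measurable_half_space : measurable half_space.
Proof.
rewrite (_ : half_space = setT `&` height @^-1` `]0, +oo[).
  by apply: (@measurable_coord _ R 1 m ord0 ord_max).
by rewrite setTI; apply/seteqP; split => x /=; rewrite in_itv/= andbT.
Qed.

Definition hyp_volume (A : set 'rV[R]_m) : \bar R :=
  (\int[lebesgue_rV R m]_(x in A `&` half_space) (height x ^- m)%:E)%E.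

Let measurable_density (A : set 'rV[R]_m) : measurable A ->
  measurable_fun (A `&` half_space) (EFin \o (fun x => (height x) ^- m)).
Proof.
move=> mA; apply/measurable_EFinP.
apply: (@eq_measurable_fun _ _ _ _ _
  ((@powR R ^~ (- m%:R)) \o height)) => [x|].
  rewrite inE => -[_ x0] /=; rewrite powRN powR_mulrn//; exact: ltW.
apply: measurable_funTS; apply: measurableT_comp; first exact: measurable_powR.
exact: (@measurable_coord _ R 1 m ord0 ord_max).
Qed.

Let hyp_volume0 : hyp_volume set0 = 0%E.
Proof. by rewrite /hyp_volume set0I integral_set0. Qed.

Let density_ge0 x : half_space x -> (0 <= (height x ^- m)%:E)%E.
Proof. by move=> x0; rewrite lee_fin invr_ge0 exprn_ge0// ltW. Qed.

Let hyp_volume_ge0 A : (0 <= hyp_volume A)%E.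
Proof. by apply: integral_ge0 => x [_]; exact: density_ge0. Qed.

Let hyp_volume_sigma_additive : semi_sigma_additive hyp_volume.
Proof.
move=> F mF tF mUF; rewrite /hyp_volume setI_bigcupl ge0_integral_bigcup//=.
- by apply: is_cvg_ereal_nneg_natsum_cond => // k _ _; exact: hyp_volume_ge0.
- by move=> k; apply: measurableI => //; exact: measurable_half_space.
- by rewrite -setI_bigcupl; exact: measurable_density.
- by move=> x [k _ [_]]; exact: density_ge0.
- by apply: trivIset_setIr.
Qed.

HB.instance Definition _ := isMeasure.Build _ _ _ hyp_volume
  hyp_volume0 hyp_volume_ge0 hyp_volume_sigma_additive.

(* Functions on H^m are total functions on 'rV_m whose values outside
   half_space are irrelevant; L^p norms only see them on half_space. *)
Definition Lnorm_hyp (p : \bar R) f : \bar R :=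
  'N[hyp_volume]_p[(EFin \o f) \_ half_space]%E.

Definition hyp_metric x u v : R :=
  (\sum_(i < m) u 0 i * v 0 i) / height x ^+ 2.
Definition hyp_norm x v : R := Num.sqrt (hyp_metric x v v).

Definition partial (i : 'I_m) f x : R := 'D_(delta_mx 0 i) f x.
Definition egrad f x : 'rV[R]_m := \row_i partial i f x.

(* The gradient for the metric; hyp_gradP is its defining property. *)
Definition hyp_grad f x : 'rV[R]_m := height x ^+ 2 *: egrad f x.

Definition hyp_grad_norm f x : R := hyp_norm x (hyp_grad f x).

Let mulrCMK (a b c : R) : c != 0 -> c * a * b / c = b * a.
Proof. by move=> c0; rewrite mulrC !mulrA mulVf// mul1r mulrC. Qed.

Lemma hyp_gradP f x v : half_space x -> differentiable f x ->
  hyp_metric x (hyp_grad f x) v = 'd f x v.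
Proof.
move=> x0 df; rewrite /hyp_metric [in RHS](row_sum_delta v) linear_sum /=.
have h0 : height x ^+ 2 != 0 by rewrite sqrf_eq0 gt_eqF.
rewrite mulr_suml; apply: eq_bigr => i _.
rewrite linearZ /= !mxE /partial deriveE//.
exact: mulrCMK.
Qed.

Lemma hyp_grad_normE f x : half_space x ->
  hyp_grad_norm f x = height x * Num.sqrt (\sum_(i < m) partial i f x ^+ 2).
Proof.
move=> x0; have h0 : height x != 0 by rewrite gt_eqF.
rewrite /hyp_grad_norm /hyp_norm /hyp_metric.
rewrite (_ : _ / _ = height x ^+ 2 * \sum_(i < m) partial i f x ^+ 2).
  by rewrite sqrtrM ?sqr_ge0// sqrtr_sqr gtr0_norm.
rewrite mulr_suml mulr_sumr; apply: eq_bigr => i _; rewrite !mxE.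
by rewrite mulrCMK ?expf_neq0// expr2 -mulrA.
Qed.

(* C^oo: the partial derivatives of all orders exist and are continuous. *)
Definition smooth_hyp f : Prop :=
  forall (s : seq 'I_m) x, half_space x ->
    let g := foldr partial f s in
    {for x, continuous g} /\ forall i, derivable g x (delta_mx 0 i).

(* The closure is taken relative to half_space. *)
Definition support_hyp f : set 'rV[R]_m :=
  half_space `&` closure [set x | half_space x /\ f x != 0].

Definition smooth_compact_hyp f : Prop :=
  smooth_hyp f /\ compact (support_hyp f).

End half_space.

(* Main.v *)
From HB Require Import structures.
Require Import Defs.
From mathcomp Require Import all_boot all_order all_algebra.
From mathcomp Require Import all_classical all_reals all_analysis.
From mathcomp Require Import measurable_realfun ess_sup_inf ring lra.

Set Implicit Arguments.
Unset Strict Implicit.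
Unset Printing Implicit Defensive.

Import Order.TTheory GRing.Theory Num.Theory.
Import numFieldNormedType.Exports.

Local Open Scope classical_set_scope.
Local Open Scope ring_scope.

(** Write m = n.+1, let Q be the unit cube of R^m and, for x in the half space
and r > 0, let flow r 0 x map t in Q to the point whose coordinates are
x_i + r x_m t_i for i < m and x_m exp (r t_m) for i = m.  The decomposition is
phi2 = A_r phi and phi1 = phi - A_r phi with r = lambda, where
A_r phi (x) = int_Q phi (flow r 0 x t) dt (avg with weight 1): a mean of phi
over a cube of hyperbolic size r at x.

The average inherits smoothness from phi, so no bump function is needed.  A
partial derivative of a weighted average of phi is a finite sum of weighted
averages of partial derivatives of phi, by differentiation under the integral
and the chain rule (is_derive_avg); iterating gives derivatives of all orders,
and compactness of the support is preserved (avg_test_function).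

Everything else rests on one estimate, cube_average_grad_le.  The change of
variables y = flow r tau x t has density at most r^-m exp (n (r - tau)) with
respect to hyperbolic volume (integral_flow_le), so Hoelder's inequality bounds
the mean over Q of |grad phi| o flow by (r^-m exp (n (r - tau)))^(1/p) times
the L^p norm of the gradient.  When n r <= n, that is r <= 1 or m = 1, the
factor exp (n r) is harmless, and two bounds follow:
- x_m |d_j A_r phi (x)| is at most m times such a mean, which is the bound on
  the gradient of phi2 (grad_avg_le);
- the derivative of s |-> A_s phi (x) is at most m times such a mean, hence at
  most a multiple of s^(-m/p), which is integrable at 0 because p > m;
  integrating from 0 to r, where A_0 phi = phi, bounds phi1 (avg_dist_le).

There remains m >= 2 and lambda > 1, where phi2 = 0 works: it suffices to
bound sup |phi| by the L^p norm of the gradient, and by the second bound with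
r = 1 it is enough to bound A_1 phi.  Translating the cube downwards by a
hyperbolic distance tau makes the estimate decay like exp (- n tau / p), while
the mean of phi over the translated cube vanishes for large tau since the
support is compact; integrating the tau-derivative gives the bound (avg1_le). *)

(** * Images of measures and one-dimensional substitution *)

Section transfer.
Context {R : realType} {d1 d2 : measure_display}.
Context {T1 : measurableType d1} {T2 : measurableType d2}.
Variables (mu : {measure set T1 -> \bar R}) (nu : {measure set T2 -> \bar R}).
Variables (F : T1 -> T2) (k : T1 -> R).
Hypotheses (mF : measurable_fun setT F) (mk : measurable_fun setT k).
Hypothesis k0 : forall x, 0 <= k x.
Local Open Scope ereal_scope.

Import HBNNSimple.

(** If the image under F of the measure k mu is at most nu on measurable sets,
then the same comparison holds for integrals of nonnegative functions. *)
Lemma le_integral_transfer :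
  (forall B, measurable B -> \int[mu]_x ((k x)%:E * (\1_B (F x))%:E) <= nu B) ->
  forall u : T2 -> \bar R, measurable_fun setT u -> (forall y, 0 <= u y) ->
  \int[mu]_x ((k x)%:E * u (F x)) <= \int[nu]_y u y.
Proof.
move=> H u mu_ u0.
pose h := nnsfun_approx measurableT mu_.
have mhF n : measurable_fun setT (fun x => (h n (F x))%:E).
  by apply/measurable_EFinP; apply: measurableT_comp.
have nd x : {homo (fun n => (h n x)%:E) : m n / (m <= n)%N >-> m <= n}.
  by move=> m n mn; rewrite lee_fin; exact/lefP/nd_nnsfun_approx.
have -> : \int[mu]_x ((k x)%:E * u (F x)) =
    limn (fun n => \int[mu]_x ((k x)%:E * (h n (F x))%:E)).
  rewrite -monotone_convergence//.
  - apply: eq_integral => x _; apply/esym/cvg_lim => //.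
    apply: cvgeZl => //; exact: cvg_nnsfun_approx.
  - by move=> n; by apply: emeasurable_funM => //; exact/measurable_EFinP.
  - by move=> n x _; rewrite mule_ge0 ?lee_fin// lee_fin.
  - by move=> x _ m n mn; apply: lee_wpmul2l; [rewrite lee_fin|exact: nd].
have hn n : \int[mu]_x ((k x)%:E * (h n (F x))%:E) <= \int[nu]_y (h n y)%:E.
  under eq_integral => x _.
    rewrite fimfunE -fsumEFin// ge0_mule_fsumr; last first.
      by move=> y; rewrite nnfun_muleindic_ge0.
    over.
  rewrite ge0_integral_fsum//; last 2 first.
  - move=> r; apply: emeasurable_funM; apply/measurable_EFinP => //.
    apply: measurable_funM => //.
    apply: measurableT_comp => //; exact: measurable_indic.
  - by move=> r x _; rewrite mule_ge0 ?lee_fin// -lee_fin EFinM nnfun_muleindic_ge0.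
  rewrite integralT_nnsfun sintegralE.
  apply: lee_fsum => // r _.
  have [r0|r0] := leP 0%R r; last first.
    by rewrite preimage_nnfun0// measure0 mule0 integral0_eq// => x _;
      rewrite indicE in_set0 mulr0 mule0.
  under eq_integral => x _ do rewrite EFinM muleCA.
  rewrite ge0_integralZl//; last 2 first.
  - apply: emeasurable_funM; apply/measurable_EFinP => //.
    apply: measurableT_comp => //; exact: measurable_indic.
  - by move=> x _; rewrite mule_ge0 ?lee_fin// lee_fin.
  by rewrite lee_wpmul2l ?lee_fin//; exact: H.
apply: lime_le.
  apply: ereal_nondecreasing_is_cvgn => m n mn; apply: ge0_le_integral => //.
  - by move=> x _; rewrite mule_ge0 ?lee_fin// lee_fin.
  - by apply: emeasurable_funM => //; exact/measurable_EFinP.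
  - by apply: emeasurable_funM => //; exact/measurable_EFinP.
  - by move=> x _; apply: lee_wpmul2l; [rewrite lee_fin|exact: nd].
apply: nearW => n; apply: le_trans (hn n) _; apply: ge0_le_integral => //.
- by move=> y _; rewrite lee_fin.
- exact/measurable_EFinP.
- by move=> y _; rewrite /h nnsfun_approxE; exact: le_approx.
Qed.

End transfer.

Section image_density.
Context {R : realType} {d1 d2 : measure_display}.
Context {T1 : measurableType d1} {T2 : measurableType d2}.
Variables (mu : {measure set T1 -> \bar R}) (F : T1 -> T2) (k : T1 -> R).
Hypotheses (mF : measurable_fun setT F) (mk : measurable_fun setT k).
Local Open Scope ereal_scope.
Hypothesis k0 : forall x, 0 <= (k x)%:E.

(** The image under F of the measure with density k with respect to mu.  The
measurability and sign conditions are arguments so that the measure structure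
below can be inferred. *)
Definition image_density of measurable_fun setT F & measurable_fun setT k &
    (forall x, 0 <= (k x)%:E) : set T2 -> \bar R := fun B =>
  \int[mu]_x ((k x)%:E * (\1_B (F x))%:E).

Local Notation nu := (image_density mF mk k0).

Let mint B : measurable B ->
  measurable_fun setT (fun x => (k x)%:E * (\1_B (F x))%:E).
Proof.
move=> mB; apply: emeasurable_funM; apply/measurable_EFinP => //.
by apply: measurableT_comp => //; exact: measurable_indic.
Qed.

Let image_density0 : nu set0 = 0.
Proof.
by apply: integral0_eq => x _; rewrite indicE in_set0 mule0.
Qed.

Let image_density_ge0 B : 0 <= nu B.
Proof. by apply: integral_ge0 => x _; rewrite mule_ge0// ?lee_fin. Qed.

Let image_density_sigma_additive : semi_sigma_additive nu.
Proof.
move=> B mB tB mUB; apply: cvg_toP.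
  apply: ereal_nondecreasing_is_cvgn => m n mn.
  by apply: lee_sum_nneg_natr => // i _ _.
rewrite /image_density -integral_nneseries//; last 2 first.
- by move=> n; exact: mint.
- by move=> n x _; rewrite mule_ge0// ?lee_fin.
apply: eq_integral => x _; rewrite nneseriesZl; last first.
  by move=> n _; rewrite lee_fin.
congr (_ * _); have := @measure_semi_sigma_additive _ _ R (\d_(F x)) B mB tB mUB.
by move/cvg_lim => ->.
Qed.

HB.instance Definition _ := isMeasure.Build _ _ _ (image_density mF mk k0)
  image_density0 image_density_ge0 image_density_sigma_additive.

End image_density.

Section increasing_substitution.
Variables (R : realType) (F F' : R -> R).
Hypothesis dF : forall x : R, is_derive x (1 : R) F (F' x).
Hypothesis cF' : continuous F'.
Hypothesis F'0 : forall x, 0 <= F' x.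
Hypothesis Fmono : {mono F : x y / x <= y}.
Local Open Scope ereal_scope.
Local Notation leb := (@lebesgue_measure R).

Let k := (F' \_ `]0%R, 1%R]).

Let k0 x : 0 <= (k x)%:E.
Proof. by rewrite lee_fin /k patchE; case: ifP. Qed.

Let cF : continuous F.
Proof. by move=> x; apply: differentiable_continuous; apply/derivable1_diffP; case: (dF x). Qed.

Let mF : measurable_fun setT (F : measurableTypeR R -> measurableTypeR R).
Proof. exact: continuous_measurable_fun. Qed.

Let mk : measurable_fun setT (k : measurableTypeR R -> measurableTypeR R).
Proof.
apply/measurable_restrict => //; apply: measurable_funTS.
exact: continuous_measurable_fun.
Qed.

Let mD : measurable (~` `]F 0%R, F 1%R] : set (measurableTypeR R)).
Proof. exact: measurableC. Qed.

Let FTC u v : (u < v)%R ->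
  \int[leb]_(x in `]u, v]) (F' x)%:E = (F v - F u)%:E.
Proof.
move=> uv; rewrite integral_itv_obnd_cbnd; last first.
  by apply/measurable_EFinP/measurable_funTS; exact: continuous_measurable_fun.
rewrite (@continuous_FTC2 _ _ F)//.
- exact: continuous_subspaceT.
- split=> [x _||]; first by case: (dF x).
  + exact/cvg_at_right_filter/cF.
  + exact/cvg_at_left_filter/cF.
- by move=> x _; rewrite derive1E; apply: derive_val.
Qed.

Let Fltmono : {mono F : x y / (x < y)%R}.
Proof. exact: leW_mono. Qed.

Let preimF x : (F 0 <= x <= F 1)%R -> exists2 u, (0 <= u <= 1)%R & F u = x.
Proof.
move=> x01; have F01 : (F 0 <= F 1)%R by case/andP: x01 => /le_trans; apply.
have cF01 : {within `[0%R, 1%R], continuous F} by exact: continuous_subspaceT.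
have x01' : (Num.min (F 0) (F 1) <= x <= Num.max (F 0) (F 1))%R.
  by rewrite min_l// max_r.
have [u] := IVT ler01 cF01 x01'.
by rewrite in_itv/= => u01 <-; exists u.
Qed.

(** Completing the image of F'(t) dt on ]0, 1] by Lebesgue measure outside
]F 0, F 1] gives a measure with the right value on intervals, that is, Lebesgue
measure itself. *)
Lemma image_density_increasing (B : set (measurableTypeR R)) : measurable B ->
  image_density leb mF mk k0 B <= leb B.
Proof.
move=> mB.
pose Q := measure_add (image_density leb mF mk k0) (mrestr leb mD).
rewrite [leRHS](_ : _ = Q B); first by rewrite /Q measure_addE leeDl.
apply: lebesgue_measure_unique => // _ [[x y] _ <-] /=.
transitivity (Q `]x, y]%classic) => //; rewrite /Q measure_addE /mrestr.
rewrite (@measureDI _ _ _ leb `]x, y]%classic `]F 0%R, F 1%R]%classic)//.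
rewrite addeC setDE; congr (_ + _).
set a := Num.max x (F 0); set b := Num.min y (F 1).
have -> : `]x, y] `&` `]F 0%R, F 1%R] = `]a, b]%classic.
  apply/seteqP; split => z /=; rewrite !in_itv/= /a /b gt_max le_min.
    by move=> [/andP[-> ->] /andP[-> ->]].
  by move=> /andP[/andP[-> ->] /andP[-> ->]].
rewrite /image_density.
transitivity (\int[leb]_t ((EFin \o F') \_ [set t | a < F t <= b]%R) t); last first.
  apply: eq_integral => t _; rewrite /k !patchE indicE/= -EFinM.
  have -> : (t \in [set t | a < F t <= b]%R) =
      (t \in `]0%R, 1%R]%classic) && (F t \in `]x, y]%classic).
    apply/idP/andP; rewrite !inE/= !in_itv/= -(Fltmono 0%R t) -(Fmono t 1%R) /a /b gt_max le_min.
      by move=> /andP[/andP[-> ->] /andP[-> ->]].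
    by move=> [/andP[-> ->] /andP[-> ->]].
  by case: (t \in `]_, _]%classic); case: (F t \in _); rewrite /= ?mulr1 ?mulr0 ?mul0r.
have [ab|ba] := ltP a b; last first.
  rewrite set_itv_ge ?bnd_simp -?leNgt// measure0 integral0_eq// => t _.
  rewrite patchE; case: ifPn => //; rewrite inE/= => /andP[at_ tb].
  by have := lt_le_trans at_ tb; rewrite ltNge ba.
have [u u01 Fu] : exists2 u, (0 <= u <= 1)%R & F u = a.
  apply: preimF; rewrite /a le_max lexx orbT/= (le_trans (ltW ab))// /b ge_min lexx.
  by rewrite orbT.
have [v v01 Fv] : exists2 u, (0 <= u <= 1)%R & F u = b.
  apply: preimF; rewrite /b ge_min lexx orbT andbT (le_trans _ (ltW ab))//.
  by rewrite /a le_max lexx orbT.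
have -> : [set t | a < F t <= b]%R = `]u, v]%classic.
  by apply/seteqP; split => t /=; rewrite in_itv/= -Fu -Fv Fltmono Fmono.
rewrite -integral_mkcond FTC; last by rewrite -Fltmono Fu Fv.
apply: etrans; first exact: (lebesgue_measure_itv `]a, b]).
by rewrite /= lte_fin ab Fu Fv EFinB.
Qed.

Lemma integral_increasing_le (u : R -> \bar R) :
  measurable_fun setT (u : measurableTypeR R -> \bar R) -> (forall y, 0 <= u y) ->
  \int[leb]_(t in `]0%R, 1%R]) ((F' t)%:E * u (F t)) <= \int[leb]_y u y.
Proof.
move=> mu u0.
rewrite [leLHS](_ : _ = \int[leb]_t ((k t)%:E * u (F t))).
  by apply: le_integral_transfer => //; exact: image_density_increasing.
rewrite integral_mkcond; apply: eq_integral => t _.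
by rewrite /k !patchE; case: ifP => // _; rewrite mul0e.
Qed.

End increasing_substitution.

(** * Coordinatewise substitution in R^n *)

Lemma measurable_funT_restrict d (T : measurableType d) (R : realType)
  (D : set T) (f : T -> \bar R) : measurable D ->
  measurable_fun setT f -> measurable_fun setT (f \_ D).
Proof.
by move=> mD mf; apply/(measurable_restrictT _ _).1 => //; exact: measurable_funTS.
Qed.

Section fubini_rV.
Variable R : realType.
Local Open Scope ereal_scope.

Lemma measurable_rV_consr n (x : measurableTypeR R) :
  measurable_fun setT (fun v : 'rV[R]_n => rV_cons (x, v)).
Proof. by apply: measurableT_comp => //; exact: measurable_rV_cons. Qed.

(** Tonelli's theorem for the recursive definition of Lebesgue measure. *)
Lemma integral_lebesgue_rVS n (f : 'rV[R]_n.+1 -> \bar R) :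
  measurable_fun setT f -> (forall x, 0 <= f x) ->
  \int[lebesgue_rV R n.+1]_x f x =
  \int[@lebesgue_measure R]_x \int[lebesgue_rV R n]_v f (rV_cons (x, v)).
Proof.
move=> mf f0.
have mc := @measurable_rV_cons R n.
transitivity (\int[pushforward (@lebesgue_measure R \x lebesgue_rV R n)
    (@rV_cons R n)]_x f x).
  by apply: eq_measure_integral.
rewrite ge0_integral_pushforward//.
rewrite preimage_setT fubini_tonelli1//; first exact: measurableT_comp.
by move=> x /=.
Qed.

(** The half-open cube ]0, 1]^n. *)
Definition unit_cube n : set 'rV[R]_n := [set t | forall i, (0 < t ord0 i <= 1)%R].

Arguments unit_cube {n}.

Lemma measurable_unit_cube n : measurable (@unit_cube n).
Proof.
rewrite (_ : @unit_cube n = \bigcap_(i in [set: 'I_n])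
    ((fun x : 'rV[R]_n => x ord0 i) @^-1` `]0%R, 1%R]%classic)); last first.
  apply/seteqP; split => x /= h i; first by move=> _; rewrite /= in_itv/= h.
  by have := h i I; rewrite /= in_itv.
apply: fin_bigcap_measurable => // i _.
by rewrite -[X in measurable X]setTI; exact: measurable_coord.
Qed.

Lemma lebesgue_unit_cube n : lebesgue_rV R n (@unit_cube n) = 1.
Proof.
rewrite (_ : @unit_cube n = [set x : 'rV[R]_n | forall i, `]0%R, 1%R]%classic (x ord0 i)]).
  rewrite (@lebesgue_rV_box R n (fun=> `]0%R, 1%R]%classic))// big1// => i _.
  by rewrite lebesgue_measure_itv/= lte_fin ltr01 sube0.
by apply/seteqP; split => x /= h i; have := h i; rewrite /= in_itv.
Qed.

Lemma unit_cube_cons n (x : R) (v : 'rV[R]_n) :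
  (rV_cons (x, v) \in @unit_cube n.+1) = (x \in `]0%R, 1%R]%classic) && (v \in unit_cube).
Proof.
apply/idP/andP; rewrite !inE/= in_itv/=.
  move=> h; split; first by have := h ord0; rewrite rV_cons0.
  by move=> i; have := h (lift ord0 i); rewrite rV_consS.
move=> [h0 h] i; case: (unliftP ord0 i) => [j|] ->; first by rewrite rV_consS; exact: h.
by rewrite rV_cons0.
Qed.

(** The map applying psi i to the i-th coordinate. *)
Definition coordwise n (psi : 'I_n -> R -> R) (t : 'rV[R]_n) : 'rV[R]_n :=
  \row_i psi i (t ord0 i).

Lemma measurable_coordwise n (psi : 'I_n -> R -> R) :
  (forall i, measurable_fun setT (psi i : measurableTypeR R -> measurableTypeR R)) ->
  measurable_fun setT (coordwise psi).
Proof.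
move=> mpsi; apply: measurable_fun_matrixP => i j; rewrite (ord1 i).
rewrite (_ : (fun _ => _) = (psi j : measurableTypeR R -> measurableTypeR R) \o (fun A : 'rV[R]_n => A ord0 j)).
  apply: measurableT_comp; first exact: mpsi.
  exact: (@measurable_coord _ (measurableTypeR R) 1 n ord0 j).
by apply/funext => x; rewrite mxE.
Qed.

(** The image of Lebesgue measure on ]0, 1] under psi has density at most w. *)
Definition subst_density (psi w : R -> R) :=
  forall u : R -> \bar R, measurable_fun setT (u : measurableTypeR R -> \bar R) ->
   (forall y, 0 <= u y) ->
   \int[@lebesgue_measure R]_(t in `]0%R, 1%R]) u (psi t) <=
   \int[@lebesgue_measure R]_y (u y * (w y)%:E).

(** Densities multiply over the coordinates. *)
Lemma integral_coordwise_le n (psi w : 'I_n -> R -> R) :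
  (forall i, measurable_fun setT (psi i : measurableTypeR R -> measurableTypeR R)) ->
  (forall i, measurable_fun setT (w i : measurableTypeR R -> measurableTypeR R)) ->
  (forall i y, (0 <= w i y)%R) ->
  (forall i, subst_density (psi i) (w i)) ->
  forall v : 'rV[R]_n -> \bar R, measurable_fun setT v -> (forall y, 0 <= v y) ->
  \int[lebesgue_rV R n]_(t in unit_cube) v (coordwise psi t) <=
  \int[lebesgue_rV R n]_y (v y * (\prod_(i < n) w i (y ord0 i))%:E).
Proof.
elim: n psi w => [|n IH] psi w mpsi mw w0 H v mv v0.
  have E (t y : 'rV[R]_0) : t = y by apply/rowP => -[].
  have mT (A : set 'rV[R]_0) : measurable A.
    have [->//|/set0P[x Ax]] := eqVneq A set0.
    suff -> : A = setT by [].
    by apply/seteqP; split => // y _; rewrite (E y x).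
  have mT' (D : set 'rV[R]_0) (f : 'rV[R]_0 -> \bar R) : measurable_fun D f.
    by move=> ? B mB; exact: mT.
  rewrite /= !integral_dirac//= big_ord0 mule1 (E (coordwise _ _) 0%R).
  by rewrite diracT mul1e diracE; case: (_ \in _) => /=; rewrite ?mul1e ?mul0e.
have mprod k (w' : 'I_k -> R -> R) :
    (forall i, measurable_fun setT (w' i : measurableTypeR R -> measurableTypeR R)) ->
    measurable_fun setT (fun y : 'rV[R]_k => (\prod_(i < k) w' i (y ord0 i))%:E).
  move=> mw'; apply/measurable_EFinP; apply: measurable_prod => i _.
  apply: (@measurableT_comp _ _ _ _ _ _ (w' i)); first exact: mw'.
  exact: (@measurable_coord _ (measurableTypeR R) 1 k ord0 i).
have prod0 k (w' : 'I_k -> R -> R) (y : 'rV[R]_k) : (forall i y, (0 <= w' i y)%R) ->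
    0 <= (\prod_(i < k) w' i (y ord0 i))%:E.
  by move=> w'0; rewrite lee_fin prodr_ge0.
pose psi' i := psi (lift ord0 i); pose w' i := w (lift ord0 i).
have coordwiseS (x : R) t : coordwise psi (rV_cons (x, t)) =
    rV_cons (psi ord0 x, coordwise psi' t).
  apply/rowP => i; rewrite [LHS]mxE; case: (unliftP ord0 i) => [j|] ->.
    by rewrite !rV_consS mxE.
  by rewrite !rV_cons0.
have mvr x : measurable_fun setT (fun t : 'rV[R]_n => v (rV_cons (x, t))).
  by apply: measurableT_comp => //; exact: measurable_rV_consr.
pose U x := \int[lebesgue_rV R n]_y (v (rV_cons (x, y)) * (\prod_(i < n) w' i (y ord0 i))%:E).
have U0 x : 0 <= U x.
  by apply: integral_ge0 => y _; rewrite mule_ge0// prod0// => i ?; exact: w0.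
have mU : measurable_fun setT (U : measurableTypeR R -> \bar R).
  pose g (z : measurableTypeR R * 'rV[R]_n) :=
    v (rV_cons z) * (\prod_(i < n) w' i (z.2 ord0 i))%:E.
  rewrite (_ : U = fubini_F (lebesgue_rV R n) g)//.
  apply: measurable_fun_fubini_tonelli_F.
  - apply: emeasurable_funM.
      by apply: measurableT_comp => //; exact: measurable_rV_cons.
    apply: (@measurableT_comp _ _ _ _ _ _ (fun y : 'rV[R]_n => (\prod_(i < n) w' i (y ord0 i))%:E)) => //.
    by apply: mprod => i; exact: mw.
  - by move=> z; rewrite /g mule_ge0// prod0// => i ?; exact: w0.
rewrite integral_mkcond [leLHS]integral_lebesgue_rVS; last 2 first.
- apply: measurable_funT_restrict; first exact: measurable_unit_cube.
  by apply: measurableT_comp => //; exact: measurable_coordwise.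
- by move=> x; rewrite patchE; case: ifP.
rewrite [leRHS]integral_lebesgue_rVS; last 2 first.
- by apply: emeasurable_funM => //; exact: mprod.
- by move=> x; rewrite mule_ge0// prod0.
apply: (@le_trans _ _ (\int[@lebesgue_measure R]_(x in `]0%R, 1%R]) U (psi ord0 x))); last first.
  apply: le_trans (H ord0 _ mU U0) _.
  rewrite le_eqVlt; apply/orP; left; apply/eqP.
  apply: eq_integral => x _; rewrite -ge0_integralZr//; last 3 first.
  - by apply: emeasurable_funM => //; apply: mprod => i; exact: mw.
  - by move=> y _; rewrite mule_ge0// prod0// => i ?; exact: w0.
  - by rewrite lee_fin w0.
  apply: eq_integral => y _; rewrite big_ord_recl rV_cons0 -muleA; congr (_ * _).
  rewrite -EFinM mulrC; congr (_ * _)%:E.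
  by apply: eq_bigr => i _; rewrite rV_consS.
rewrite [leRHS]integral_mkcond; apply: ge0_le_integral => //.
- move=> x _; apply: integral_ge0 => y _; rewrite patchE; by case: ifP.
- apply: (@measurable_fun_fubini_tonelli_F _ _ _ _ _ (lebesgue_rV R n) (fun z => ((v \o coordwise psi) \_ unit_cube) (rV_cons z))).
    apply: measurableT_comp; last exact: measurable_rV_cons.
    apply: measurable_funT_restrict; first exact: measurable_unit_cube.
    by apply: measurableT_comp => //; exact: measurable_coordwise.
  by move=> z; rewrite patchE; case: ifP => _ //=.
- apply: (@measurable_funT_restrict _ _ R _ (fun t => U (psi ord0 t))); first exact: measurable_itv.
  apply: measurableT_comp; [exact: mU|exact: mpsi].
move=> x _; rewrite patchE; case: ifPn => x01; last first.
  rewrite integral0_eq// => y _.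
  by rewrite patchE unit_cube_cons (negbTE x01).
apply: le_trans (IH psi' w' _ _ _ _ (fun t => v (rV_cons (psi ord0 x, t))) _ _).
- rewrite [leRHS]integral_mkcond le_eqVlt; apply/orP; left; apply/eqP.
  apply: eq_integral => y _; rewrite !patchE unit_cube_cons x01/=.
  by rewrite coordwiseS.
- by move=> i; exact: mpsi.
- by move=> i; exact: mw.
- by move=> i y; exact: w0.
- by move=> i; exact: H.
- exact: mvr.
- by move=> y.
Qed.

End fubini_rV.

(** * Affine and exponential substitutions *)

Lemma is_derive_affine (R : realType) (b a t : R) :
  is_derive t (1 : R) (fun s => b + a * s) a.
Proof.
have H := is_deriveD (is_derive_cst b t (1 : R)) (is_deriveZ (f := id) a (is_derive_id t (1 : R))).
by apply: is_derive_eq H _; rewrite add0r [RHS]/= [LHS]mulr1.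
Qed.

Lemma is_derive_expR_affine (R : realType) (h c b t : R) :
  is_derive t (1 : R) (fun s => h * expR (c * s - b)) (c * (h * expR (c * t - b))).
Proof.
have H1 : is_derive t (1 : R) (fun s => c * s - b) c.
  have := is_derive_affine (- b) c t.
  by congr is_derive; apply/funext => s; rewrite addrC.
have H := is_deriveZ h (is_derive1_comp (f := expR) (g := fun s => c * s - b) (x := t) (is_derive_expR (c * t - b)) H1).
by apply: is_derive_eq H _; rewrite -[LHS]/(h * (expR (c * t - b) * c)) [LHS]mulrA [LHS]mulrC.
Qed.

Lemma measurable_invr_pos (R : realType) (c : R) :
  measurable_fun setT ((fun y => c^-1 * y `^ (-1)) : measurableTypeR R -> measurableTypeR R).
Proof. by apply: measurable_funM => //; exact: measurable_powR. Qed.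

Section one_dim.
Variable R : realType.
Local Open Scope ereal_scope.

Lemma subst_density_affine (x a : R) : (0 < a)%R ->
  subst_density (fun t => x + a * t)%R (fun=> a^-1%R).
Proof.
move=> a0 u mu u0.
have ge0 : 0 <= (a^-1)%:E by rewrite lee_fin invr_ge0 ltW.
apply: le_trans (@integral_increasing_le R (fun t => x + a * t)%R (fun=> a) _ _ _ _
  (fun y => u y * (a^-1)%:E) _ _).
- rewrite le_eqVlt; apply/orP; left; apply/eqP; apply: eq_integral => t _.
  by rewrite muleC -muleA -EFinM mulVf ?gt_eqF// mule1.
- by move=> y; exact: is_derive_affine.
- by move=> y; exact: cvg_cst.
- by move=> y; exact: ltW.
- by move=> y z; rewrite lerD2l ler_pM2l.
- by apply: emeasurable_funM.
- by move=> y; rewrite mule_ge0.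
Qed.

(** The density 1 / (c y) is written with powR so that it is nonnegative, and
measurable, on the whole line; its values for y <= 0 play no role. *)
Lemma subst_density_expR (h c b : R) : (0 < h)%R -> (0 < c)%R ->
  subst_density (fun t => h * expR (c * t - b))%R
               (fun y => c^-1 * y `^ (-1))%R.
Proof.
move=> h0 c0 u mu u0.
have F0 t : (0 < h * expR (c * t - b))%R by rewrite mulr_gt0// expR_gt0.
have w0 y : 0 <= (c^-1 * y `^ (-1))%:E :> \bar R.
  by rewrite lee_fin mulr_ge0// ?powR_ge0// invr_ge0 ltW.
have dF t := is_derive_expR_affine h c b t.
apply: le_trans (@integral_increasing_le R (fun t => h * expR (c * t - b))%R
  (fun t => c * (h * expR (c * t - b)))%R _ _ _ _
  (fun y => u y * (c^-1 * y `^ (-1))%:E) _ _).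
- rewrite le_eqVlt; apply/orP; left; apply/eqP; apply: eq_integral => t _.
  rewrite muleC -muleA -EFinM powR_inv1 ?ltW// mulrACA mulVf ?gt_eqF// mul1r.
  by rewrite mulVf ?mule1// gt_eqF.
- move=> y; apply: (@continuousM _ _ (cst c) (fun t => h * expR (c * t - b))%R); first exact: cvg_cst.
  by apply/differentiable_continuous/derivable1_diffP; case: (dF y).
- by move=> y; rewrite mulr_ge0// ltW.
- by move=> y z; rewrite ler_pM2l// ler_expR lerD2r ler_pM2l.
- by apply: emeasurable_funM => //; apply/measurable_EFinP; exact: measurable_invr_pos.
- by move=> y; rewrite mule_ge0.
Qed.

End one_dim.

(** * The flow and its density for the hyperbolic volume *)

Lemma flow_density_bound (R : realFieldType) (n : nat) (r h y E : R) :
  0 < r -> 0 < h -> 0 < y -> y ^+ n <= h ^+ n * E ->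
  (r * h)^-1 ^+ n * (r^-1 / y) <= r ^- n.+1 * E / y ^+ n.+1.
Proof.
move=> r0 h0 y0; rewrite exprVn exprMn !exprS.
have : 0 < h ^+ n by rewrite exprn_gt0.
have : 0 < y ^+ n by rewrite exprn_gt0.
have : 0 < r ^+ n by rewrite exprn_gt0.
move: (h ^+ n) (y ^+ n) (r ^+ n) => H Y P P0 Y0 H0 YH.
rewrite [leLHS](_ : _ = Y / (P * H * r * y * Y)); last by field; rewrite ?gt_eqF.
rewrite [leRHS](_ : _ = H * E / (P * H * r * y * Y)); last by field; rewrite ?gt_eqF.
by rewrite ler_pM2r// invr_gt0 !mulr_gt0.
Qed.

Section flow.
Variables (R : realType) (n : nat).
Local Notation m := n.+1.
Local Notation Q := (@unit_cube R m).
Local Notation leb := (lebesgue_rV R m).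
Implicit Types (x t : 'rV[R]_m) (r tau : R).

(** The i-th coordinate of flow, as a function of the i-th coordinate of t. *)
Definition flow_coord r tau x (i : 'I_m) (s : R) : R :=
  if i == ord_max then height x * expR (r * s - tau) else x 0 i + r * height x * s.

(** A parametrization, over t in the unit cube, of a cube of hyperbolic size r at
the point x, translated downwards by the hyperbolic distance tau: the height is
multiplied by exp (- tau). *)
Definition flow r tau x : 'rV[R]_m -> 'rV[R]_m := coordwise (flow_coord r tau x).

Lemma flowE r tau x t i : flow r tau x t 0 i = flow_coord r tau x i (t 0 i).
Proof. by rewrite mxE. Qed.

Lemma height_flow r tau x t :
  height (flow r tau x t) = height x * expR (r * height t - tau) :> R.
Proof. by rewrite /height flowE /flow_coord eqxx. Qed.

Lemma half_space_flow r tau x t : half_space x -> half_space (flow r tau x t).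
Proof. by move=> x0; change (0 < height (flow r tau x t)); rewrite height_flow mulr_gt0 ?expR_gt0. Qed.

Lemma flow0 x t : flow 0 0 x t = x.
Proof.
apply/rowP => i; rewrite flowE /flow_coord !mul0r subr0 expR0 mulr1 addr0.
by case: eqP => // ->.
Qed.

Lemma measurable_flow_coord r tau x i :
  measurable_fun setT (flow_coord r tau x i : measurableTypeR R -> measurableTypeR R).
Proof.
rewrite (_ : flow_coord r tau x i = fun s => if i == ord_max
  then height x * expR (r * s - tau) else x 0 i + r * height x * s)//.
case: (i == ord_max); apply: continuous_measurable_fun => s.
  by apply/differentiable_continuous/derivable1_diffP; case: (is_derive_expR_affine (height x) r tau s).
by apply/differentiable_continuous/derivable1_diffP; case: (is_derive_affine (x 0 i) (r * height x) s).
Qed.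

Lemma measurable_flow r tau x : measurable_fun setT (flow r tau x).
Proof. by apply: measurable_coordwise => i; exact: measurable_flow_coord. Qed.

Lemma measurable_height : measurable_fun setT (@height R n).
Proof. exact: (@measurable_coord _ (measurableTypeR R) 1 m ord0 ord_max). Qed.

Local Open Scope ereal_scope.

(** The change of variables y = flow r tau x t: the product of the coordinate
densities is (r x_m)^-n (r y_m)^-1, and y_m <= x_m exp (r - tau) on the image. *)
Lemma integral_flow_le r tau x (u : 'rV[R]_m -> \bar R) :
  (0 < r)%R -> half_space x -> measurable_fun setT u -> (forall y, 0 <= u y) ->
  \int[leb]_(t in Q) u (flow r tau x t) <=
  (r ^- m * expR (n%:R * (r - tau)))%:E * \int[@hyp_volume R n]_y u y.
Proof.
move=> r0 x0 mu u0.
set c := (r ^- m * _)%R.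
have c0 : (0 <= c)%R by rewrite mulr_ge0 ?expR_ge0 // invr_ge0 exprn_ge0 ?ltW.
pose c' := NngNum c0.
rewrite (_ : c = c'%:num)// -ge0_integral_mscale//.
rewrite [leLHS](_ : _ = \int[leb]_t ((\1_Q t)%:E * u (flow r tau x t))); last first.
  rewrite integral_mkcond; apply: eq_integral => t _.
  by rewrite patchE indicE; case: ifP => _; rewrite ?mul1e ?mul0e.
apply: le_integral_transfer => //.
- exact: measurable_flow.
- by apply: measurable_indic; exact: measurable_unit_cube.
move=> B mB.
(* the image of the cube lies in the half space, at height at most
   height x * expR (r - tau) *)
pose D := B `&` (@half_space R n `&` [set y | height y <= height x * expR (r - tau)]%R).
have mD : measurable D.
  apply: measurableI => //; apply: measurableI; first exact: measurable_half_space.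
  rewrite -[X in measurable X]setTI.
  rewrite (_ : [set y | _] = @height R n @^-1` `]-oo, (height x * expR (r - tau))%R]).
    exact: measurable_height.
  by apply/seteqP; split => y; rewrite /= in_itv.
pose w (i : 'I_m) (y : R) : R := if i == ord_max then (r^-1 * y `^ (-1))%R else ((r * height x)^-1)%R.
have -> : \int[leb]_t ((\1_Q t)%:E * (\1_B (flow r tau x t))%:E) =
    \int[leb]_(t in Q) (\1_D (flow r tau x t))%:E.
  rewrite [RHS]integral_mkcond; apply: eq_integral => t _.
  rewrite patchE indicE; case: ifPn => tQ; rewrite ?mul0e ?mul1e// !indicE.
  congr (_%:R)%:E; congr nat_of_bool; apply/idP/idP; rewrite !inE /D//=; last by case.
  move=> Bt; split => //; split; first exact: half_space_flow.
  rewrite height_flow ler_pM2l// ler_expR lerD2r ger_pMr//.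
  by move: tQ; rewrite inE/= => /(_ ord_max) /andP[].
have w0 i y : (0 <= w i y)%R.
  rewrite /w; case: ifP => _; first by rewrite mulr_ge0 ?powR_ge0// invr_ge0 ltW.
  by rewrite invr_ge0 mulr_ge0// ltW.
apply: le_trans (@integral_coordwise_le R m (flow_coord r tau x) w _ _ _ _ (fun y => (\1_D y)%:E) _ _) _ => //.
- exact: measurable_flow_coord.
- move=> i; rewrite /w; case: (i == ord_max) => //; exact: measurable_invr_pos.
- move=> i; rewrite /w /flow_coord; case: (i == ord_max); first exact: subst_density_expR.
  by apply: subst_density_affine; rewrite mulr_gt0.
- by apply/measurable_EFinP; exact: measurable_indic.
have mBH : measurable (B `&` @half_space R n).
  by apply: measurableI => //; exact: measurable_half_space.
pose f (y : 'rV[R]_m) : R := (height y `^ (- m%:R))%R.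
have mf : measurable_fun setT f.
  by apply: (measurableT_comp (measurable_powR _)); exact: measurable_height.
have fE y : half_space y -> f y = (height y ^- m)%R.
  by move=> y0; rewrite /f powRN powR_mulrn// ltW.
rewrite [leRHS](_ : _ =
    \int[leb]_(y in B `&` @half_space R n) (c * f y)%:E); last first.
  transitivity (c%:E * \int[leb]_(y in B `&` @half_space R n) (f y)%:E).
    rewrite [LHS](_ : _ = c%:E * hyp_volume B)//; congr (_ * _).
    by apply: eq_integral => y; rewrite inE => -[_ y0]; rewrite fE.
  rewrite -ge0_integralZl//.
  - by apply/measurable_EFinP; exact: measurable_funTS.
  - by move=> y _; rewrite lee_fin powR_ge0.
rewrite [leRHS]integral_mkcond; apply: ge0_le_integral => //.
- by move=> y _; rewrite mule_ge0// lee_fin prodr_ge0.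
- apply: emeasurable_funM; apply/measurable_EFinP; first exact: measurable_indic.
  apply: measurable_prod => i _.
  apply: (@measurableT_comp _ _ _ _ _ _ (w i)); last exact: (@measurable_coord _ (measurableTypeR R) 1 m ord0 i).
  by rewrite /w; case: (i == ord_max) => //; exact: measurable_invr_pos.
- by apply: measurable_funT_restrict => //; apply/measurable_EFinP; exact: measurable_funM.
move=> y _; rewrite patchE indicE.
have [yD|yD] := boolP (y \in D); last first.
  by rewrite mul0e; case: ifP => // _; rewrite lee_fin mulr_ge0// powR_ge0.
move: (yD); rewrite inE => -[yB [yH yh]].
rewrite mem_set// mul1e lee_fin fE// big_ord_recr/= {2}/w eqxx.
have y0 : (0 < height y)%R := yH.
rewrite (eq_bigr (fun=> (r * height x)^-1)%R); last first.
  by move=> i _; rewrite /w -val_eqE/= ltn_eqF.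
rewrite big_const_ord iter_mulr_1 powR_inv1; last exact: ltW.
rewrite -[y ord0 ord_max]/(height y).
have yh' : (height y ^+ n <= height x ^+ n * expR (n%:R * (r - tau)))%R.
  rewrite expRM_natl -exprMn lerXn2r// nnegrE; first exact: ltW.
  by rewrite mulr_ge0 ?expR_ge0// ltW.
exact: flow_density_bound.
Qed.

End flow.

(** * Borel sets of R^n *)

Section open_rV.
Variables (R : realType) (k : nat).

(** An open set is the countable union of the rational boxes it contains. *)
Lemma open_measurable_rV (U : set 'rV[R]_k) : open U -> measurable U.
Proof.
move=> oU.
pose box (q : 'rV[rat]_k * nat) : set 'rV[R]_k :=
  [set x | forall i, x ord0 i \in `]ratr (q.1 ord0 i) - q.2.+1%:R^-1, ratr (q.1 ord0 i) + q.2.+1%:R^-1[].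
have mbox q : measurable (box q).
  rewrite (_ : box q = \bigcap_(i in [set: 'I_k]) ((fun x : 'rV[R]_k => x ord0 i) @^-1`
     `]ratr (q.1 ord0 i) - q.2.+1%:R^-1, ratr (q.1 ord0 i) + q.2.+1%:R^-1[%classic)); last first.
    by apply/seteqP; split => x h i *; [exact: (h i)|exact: (h i I)].
  apply: fin_bigcap_measurable => // i _.
  by rewrite -[X in measurable X]setTI; exact: (@measurable_coord _ (measurableTypeR R) 1 k ord0 i).
rewrite (_ : U = \bigcup_q (if `[< box q `<=` U >] then box q else set0)).
  apply: countable_bigcupT_measurable => [|q]; last by case: ifP.
  exact: countableP.
apply/seteqP; split => [x Ux|x [q _]]; last by case: ifPn => // /asboolP; apply.
have /nbhs_ballP[e /= e0 eU] : nbhs x U by exact: open_nbhs_nbhs.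
have [N Ne] : exists N : nat, N.+1%:R^-1 < e / 2 :> R.
  have e2 : 0 < e / 2 by rewrite divr_gt0.
  have [N _ HN] := near_infty_natSinv_lt (PosNum e2).
  by exists N; exact: HN (leqnn _).
have qi i : exists q : rat, ratr q \in `]x ord0 i - N.+1%:R^-1, x ord0 i + N.+1%:R^-1[.
  by have [|q Hq] := @rat_in_itvoo R (x ord0 i - N.+1%:R^-1) (x ord0 i + N.+1%:R^-1);
    [rewrite ltrD2l gtrN ?invr_gt0|exists q].
have [q Hq] := choice qi.
pose qq : 'rV[rat]_k * nat := (\row_i q i, N).
have bx : box qq x.
  move=> i /=; have := Hq i; rewrite mxE !in_itv/=.
  by move: (_^-1) (ratr _) (x _ _) => a b c /andP[h1 h2]; apply/andP; split; lra.
have bU : box qq `<=` U.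
  move=> z bz; apply: eU; split => // i j; rewrite (ord1 i).
  have := Hq j; have := bz j; rewrite /= mxE !in_itv/= /ball/= ltr_distl.
  move: (N.+1%:R^-1 : R) (ratr _) (x _ _) (z _ _) Ne => a b c d Ne' /andP[h1 h2] /andP[h3 h4].
  by apply/andP; split; lra.
by exists qq => //; case: ifPn => // /negP; case; apply/asboolP.
Qed.

Lemma continuous_measurable_rV (D : set 'rV[R]_k) (f : 'rV[R]_k -> R) : open D ->
  (forall x, D x -> {for x, continuous f}) ->
  measurable_fun D (f : _ -> measurableTypeR R).
Proof.
move=> oD cf; apply: (measurability _ (RGenOInfty.measurableE R)).
move=> /= _ [_ [a ->]] <-; apply: open_measurable_rV.
rewrite openE => x /= [Dx]; rewrite /= in_itv/= andbT => ax.
apply: filterI; first exact: open_nbhs_nbhs.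
have := cf x Dx; move/cvgr_gt => /(_ _ ax); apply: filterS => z.
by rewrite /= in_itv/= andbT.
Qed.

End open_rV.

(** * Calculus on the half space *)

Section calculus.
Variables (R : realType) (n : nat).
Local Notation m := n.+1.
Local Notation H := (@half_space R n).
Implicit Types (x y z : 'rV[R]_m) (f : 'rV[R]_m -> R).

Lemma open_half_space : open H.
Proof.
rewrite openE => x x0; have : 0 < height x by [].
have := @coord_continuous R 1 m ord0 ord_max x.
by move=> /cvgr_gt; apply.
Qed.

Lemma is_derive_line f x (v : 'rV[R]_m) (s : R) : derivable f (x + s *: v) v ->
  is_derive s (1 : R) (fun s => f (x + s *: v)) ('D_v f (x + s *: v)).
Proof.
move=> df.
have E : (fun h : R => h^-1 *: (((fun s => f (x + s *: v)) \o shift s) (h *: (1 : R)) - f (x + s *: v))) =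
  (fun h : R => h^-1 *: ((f \o shift (x + s *: v)) (h *: v) - f (x + s *: v))).
  apply/funext => h /=; congr (_ *: (f _ - _)).
  by rewrite [h *: 1]mulr1 scalerDl addrCA.
by apply: DeriveDef; rewrite /derivable /derive E.
Qed.

Lemma half_space_between y z (xi : 'rV[R]_m) : H y -> H z ->
  (exists2 th : R, 0 <= th <= 1 & xi 0 ord_max = y 0 ord_max + th * (z 0 ord_max - y 0 ord_max)) -> H xi.
Proof.
rewrite /half_space /height /= => y0 z0 [th /andP[t0 t1] ->].
have -> : y 0 ord_max + th * (z 0 ord_max - y 0 ord_max) = (1 - th) * y 0 ord_max + th * z 0 ord_max by ring.
move: t0; rewrite le_eqVlt => /predU1P[<-|t0].
  by rewrite subr0 mul1r mul0r addr0.
rewrite addrC ltr_pwDl//; first by rewrite mulr_gt0.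
by rewrite mulr_ge0 ?subr_ge0// ltW.
Qed.

(** Mean value theorem along the edges of the box with opposite vertices y and z,
changing one coordinate at a time. *)
Lemma sum_partial_MVT f y z :
  (forall x, H x -> forall i, derivable f x (delta_mx 0 i)) -> H y -> H z ->
  exists xi : 'I_m -> 'rV[R]_m,
    (forall k, H (xi k) /\ forall j, `|xi k 0 j - y 0 j| <= `|z 0 j - y 0 j|) /\
    f z - f y = \sum_(i < m) partial i f (xi i) * (z 0 i - y 0 i).
Proof.
move=> df y0 z0.
(* mix k has the first k coordinates of z and the others of y *)
pose mix k : 'rV[R]_m := \row_(j < m) if (j < k)%N then z 0 j else y 0 j.
have key (k : 'I_m) : exists xi : 'rV[R]_m,
    (H xi /\ forall j, `|xi 0 j - y 0 j| <= `|z 0 j - y 0 j|) /\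
    f (mix k.+1) - f (mix k) = partial k f xi * (z 0 k - y 0 k).
  pose d := z 0 k - y 0 k.
  pose line (th : R) := mix k + (th * d) *: delta_mx 0 k.
  have lineE th j : 0 <= th <= 1 -> exists2 t : R, 0 <= t <= 1 & line th 0 j = y 0 j + t * (z 0 j - y 0 j).
    move=> th01; rewrite !mxE/=; case: (ltngtP j k) => [jk|jk|/val_inj ->].
    - exists 1; rewrite ?ler01 ?lexx//.
      by rewrite (_ : (j == k) = false) ?mulr0; [ring|apply/negbTE; rewrite neq_ltn jk].
    - exists 0; rewrite ?ler01 ?lexx//.
      by rewrite (_ : (j == k) = false) ?mulr0; [ring|apply/negbTE; rewrite neq_ltn jk orbT].
    - by exists th => //; rewrite eqxx mulr1.
  have lineH th : 0 <= th <= 1 -> H (line th).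
    by move=> th01; apply: (half_space_between y0 z0); exact: lineE.
  have dline (th : R) : 0 <= th <= 1 ->
      is_derive th (1 : R) (f \o line) (partial k f (line th) * d).
    move=> th01.
    have dd : is_derive th (1:R) (fun t : R => t * d) d.
      have := is_derive_affine 0 d th.
      by congr is_derive; apply/funext => s; rewrite add0r mulrC.
    apply: (@is_derive1_comp _ (fun s : R => f (mix k + s *: delta_mx 0 k)) (fun t => t * d) _ _ _ _ dd).
    exact: is_derive_line (df _ (lineH _ th01) k).
  have [||c c01] := @MVT_segment R (f \o line) (fun th => partial k f (line th) * d) 0 1 ler01.
  - by move=> t; rewrite in_itv/= => /andP[t0 t1]; apply: dline; rewrite !ltW.
  - apply: derivable_within_continuous => t; rewrite in_itv/= => t01.
    by case: (dline t t01).
  rewrite subr0 mulr1 /= => E; exists (line c).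
  move: c01; rewrite in_itv/= => c01.
  split; first split; first exact: lineH.
    move=> j; have [t /andP[t0 t1] ->] := lineE c j c01.
    by rewrite addrC addKr normrM (ger0_norm t0) ler_piMl.
  rewrite -E; congr (f _ - f _); apply/rowP => j; rewrite !mxE/=.
    rewrite mul1r; case: (ltngtP j k) => [jk|jk|/val_inj ->].
    - by rewrite ltnS ltnW// (_ : (j == k) = false) ?mulr0 ?addr0//; apply/negbTE; rewrite neq_ltn jk.
    - by rewrite ltnS leqNgt jk/= (_ : (j == k) = false) ?mulr0 ?addr0//; apply/negbTE; rewrite neq_ltn jk orbT.
    - by rewrite ltnSn eqxx mulr1 /d addrCA subrr addr0.
  by rewrite mul0r mul0r addr0.
have [xi Hxi] := choice key.
exists xi; split; first by move=> k; case: (Hxi k).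
transitivity (\sum_(i < m) (f (mix i.+1) - f (mix i))).
  rewrite -(big_mkord xpredT (fun i => f (mix i.+1) - f (mix i))) telescope_sumr//.
  by congr (f _ - f _); apply/rowP => j; rewrite mxE// ltn_ord.
by apply: eq_bigr => i _; case: (Hxi i).
Qed.

Lemma cvg_rV (T : Type) (F : set_system T) {FF : Filter F} (f : T -> 'rV[R]_m) x :
  (forall i, f t 0 i @[t --> F] --> x 0 i) -> f t @[t --> F] --> x.
Proof.
move=> cf; apply/cvgrPdist_le => /= e e0; near=> t.
rewrite /Num.Def.normr/= mx_normrE (bigmax_le _ (ltW e0))//= => -[i j] _ /=.
rewrite !mxE (ord1 i); move: j; near: t; apply: filter_forall => /= j.
exact: ((cvgrPdist_le _ _).1 (cf j)).
Unshelve. all: by end_near. Qed.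

Lemma is_derive_continuous (g : R -> R) (s dg : R) : is_derive s (1 : R) g dg ->
  g h @[h --> s] --> g s.
Proof. by case=> dg' _; apply: differentiable_continuous; apply/derivable1_diffP. Qed.

(** Chain rule along a curve.  Only continuity of the partial derivatives at the
point is used; no Frechet differentiability is needed. *)
Lemma is_derive_curve f (gam : R -> 'rV[R]_m) (dgam : 'rV[R]_m) (s : R) :
  (forall x, H x -> forall i, derivable f x (delta_mx 0 i)) ->
  H (gam s) ->
  (forall i, {for gam s, continuous (partial i f)}) ->
  (forall i, is_derive s (1 : R) (fun t => gam t 0 i) (dgam 0 i)) ->
  is_derive s (1 : R) (f \o gam) (\sum_(i < m) partial i f (gam s) * dgam 0 i).
Proof.
move=> df gs0 cf dg.
have cg : gam t @[t --> s] --> gam s.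
  by apply: cvg_rV => i; exact: is_derive_continuous (dg i).
have cgs : gam (h + s) @[h --> 0^'] --> gam s.
  apply: cvg_comp cg.
  have : (fun h => h + s) @ 0^' --> 0 + s.
    by apply: cvgD; [exact: cvg_within|exact: cvg_cst].
  by rewrite add0r.
have xiE h : exists xi : 'I_m -> 'rV[R]_m, H (gam (h + s)) ->
    (forall k, H (xi k) /\ forall j, `|xi k 0 j - gam s 0 j| <= `|gam (h + s) 0 j - gam s 0 j|) /\
    f (gam (h + s)) - f (gam s) = \sum_(i < m) partial i f (xi i) * (gam (h + s) 0 i - gam s 0 i).
  have [g0|g0] := pselect (H (gam (h + s))); last by exists (fun=> 0).
  by have [xi Hxi] := sum_partial_MVT df gs0 g0; exists xi.
have [xi Hxi] := choice xiE.
have nearH : \forall h \near 0^', H (gam (h + s)).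
  exact: (cgs H (open_nbhs_nbhs (conj open_half_space gs0))).
have cxi k : xi h k @[h --> 0^'] --> gam s.
  apply: cvg_rV => j; apply/cvgrPdist_le => e e0.
  have cj : gam (h + s) 0 j @[h --> 0^'] --> gam s 0 j.
    exact: (cvg_comp _ _ cgs (@coord_continuous R 1 m 0 j (gam s))).
  near=> h; have gH : H (gam (h + s)) by near: h.
  have [/(_ k)[_ /(_ j)] + _] := Hxi h gH.
  rewrite distrC => /le_trans; apply; rewrite distrC.
  by near: h; move/cvgrPdist_le : cj; exact.
have main : (fun h => h^-1 *: (((f \o gam) \o shift s) (h *: (1 : R)) - (f \o gam) s)) @ 0^' -->
    \sum_(i < m) partial i f (gam s) * dgam 0 i.
  apply: (@cvg_trans _ ((fun h => \sum_(i < m) partial i f (xi h i) * (h^-1 *: (gam (h *: (1:R) + s) 0 i - gam s 0 i))) @ 0^')).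
    apply: near_eq_cvg; near=> h.
    have gH : H (gam (h + s)) by near: h.
    have [_] := Hxi h gH; rewrite /= [h *: 1]mulr1 => ->.
    rewrite scaler_sumr; apply: eq_bigr => i _.
    by rewrite [in RHS]/GRing.scale/= mulrCA.
  apply: cvg_big => // [|i _]; first exact: add_continuous.
  apply: cvgM.
    exact: (cvg_comp _ _ (cxi i) (cf i)).
  by case: (dg i) => /cvg_ex[l Hl] <-; rewrite /derive (cvg_lim _ Hl).
apply: DeriveDef; first by apply/cvg_ex; eexists; exact: main.
exact: (cvg_lim _ main).
Unshelve. all: by end_near. Qed.

Lemma lipschitz_half_space f (M : R) y z :
  (forall x, H x -> forall i, derivable f x (delta_mx 0 i)) ->
  (forall i x, H x -> `|partial i f x| <= M) ->
  H y -> H z -> `|f z - f y| <= M * \sum_(i < m) `|z 0 i - y 0 i|.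
Proof.
move=> df fM y0 z0; have [xi [Hxi ->]] := sum_partial_MVT df y0 z0.
rewrite mulr_sumr; apply: le_trans (ler_norm_sum _ _ _) _; apply: ler_sum => i _.
by rewrite normrM ler_wpM2r// fM//; case: (Hxi i).
Qed.

End calculus.

(** * Test functions *)

Section test_functions.
Variables (R : realType) (n : nat).
Local Notation m := n.+1.
Local Notation H := (@half_space R n).
Implicit Types (x y z : 'rV[R]_m) (f g : 'rV[R]_m -> R).

Lemma continuous_bounded_on (K : set 'rV[R]_m) f : compact K ->
  (forall x, K x -> {for x, continuous f}) -> exists2 M, 0 < M & forall x, K x -> `|f x| <= M.
Proof.
move=> cK cf.
have : {within K, continuous f}.
  by apply: continuous_in_subspaceT => x; rewrite inE; exact: cf.
move=> /continuous_compact /(_ cK) /compact_bounded [M [_ HM]].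
exists (`|M| + 1); first by rewrite ltr_pwDr.
by move=> x Kx; apply: HM; [rewrite ltr_pwDr// ler_norm|exists x].
Qed.

Lemma continuous_height : continuous (@height R n).
Proof. exact: coord_continuous. Qed.

Lemma ler_coord_norm x i : `|x 0 i| <= `|x|.
Proof.
rewrite [leRHS]/Num.Def.normr/= mx_normrE.
exact: (le_bigmax _ (fun ij : 'I_1 * 'I_m => `|x ij.1 ij.2|) (0, i)).
Qed.

(** Points at height at least delta with coordinates bounded by rho: a compact
subset of the half space. *)
Definition box (delta rho : R) : set 'rV[R]_m :=
  [set x | delta <= height x /\ forall i, `|x 0 i| <= rho].

(** Equivalent to compactness of support_hyp f; see smooth_compact_box and
box_smooth_compact. *)
Definition box_supported f := exists delta rho, 0 < delta /\
  forall x, H x -> f x != 0 -> box delta rho x.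

Lemma box_sub delta rho : 0 < delta -> box delta rho `<=` H.
Proof. by move=> d0 x [/(lt_le_trans d0)]. Qed.

Lemma compact_box delta rho : compact (box delta rho).
Proof.
have := @rV_compact R m (fun i => if i == ord_max then `[delta, rho]%classic `&` `[- rho, rho]%classic else `[- rho, rho]%classic) _.
rewrite (_ : [set v | _] = box delta rho); first apply.
  move=> i; case: ifP => _; last exact: segment_compact.
  apply: (subclosed_compact _ (@segment_compact R (-rho) rho)); last exact: subIsetr.
  by apply: closedI; exact: itv_closed.
apply/seteqP; split => x /=.
  move=> h; split.
    have := h ord_max; rewrite eqxx /= => -[]; rewrite in_itv/= => /andP[].
    by [].
  move=> i; have := h i; case: ifP => _; last by rewrite /= in_itv/= ler_norml.
  by move=> [_]; rewrite /= in_itv/= ler_norml.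
move=> [dx hx] i; have := hx i; rewrite ler_norml; case: ifP => [/eqP ->|_] h; last by rewrite /= in_itv.
by split; rewrite /= in_itv//= dx/=; case/andP: h.
Qed.

Lemma closed_box delta rho : closed (box delta rho).
Proof. by apply: compact_closed; [exact: norm_hausdorff|exact: compact_box]. Qed.

Lemma smooth_compact_box f : smooth_compact_hyp f -> box_supported f.
Proof.
move=> [_ cK].
have [M1 M10 HM1] : exists2 M, 0 < M & forall x, support_hyp f x -> `|(height x)^-1| <= M.
  apply: (continuous_bounded_on cK) => x [x0 _].
  by apply: continuousV; [rewrite gt_eqF|exact: continuous_height].
have /compact_bounded[M2 [_ HM2]] := cK.
exists M1^-1, (M2 + 1); split; first by rewrite invr_gt0.
move=> x x0 fx.
have Kx : support_hyp f x by split => //; apply: subset_closure.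
split.
  rewrite invf_ple// ?posrE//.
  by have := HM1 x Kx; rewrite gtr0_norm// invr_gt0.
move=> i; apply: le_trans (ler_coord_norm _ _) _; apply: HM2 => //.
by rewrite ltrDl.
Qed.

Lemma box_smooth_compact f : smooth_hyp f -> box_supported f -> smooth_compact_hyp f.
Proof.
move=> sf [delta [rho [d0 bf]]]; split => //.
have sub : closure [set x | H x /\ f x != 0] `<=` box delta rho.
  rewrite [X in _ `<=` X](closure_id (box delta rho)).1; last exact: closed_box.
  by apply: closure_subset => x [x0 fx]; exact: bf.
rewrite /support_hyp setIidr; last exact: subset_trans sub (box_sub d0).
exact: (subclosed_compact (@closed_closure _ _) (@compact_box delta rho) sub).
Qed.

Lemma smooth_partial f i : smooth_hyp f -> smooth_hyp (partial i f).
Proof.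
by move=> sf s x x0; have := sf (rcons s i) x x0; rewrite foldr_rcons.
Qed.

Lemma near_eq_partial f g i x : H x -> (forall y, H y -> f y = g y) ->
  partial i f x = partial i g x.
Proof.
move=> x0 fg; apply: near_eq_derive.
have := open_nbhs_nbhs (conj (@open_half_space R n) x0).
by apply: filterS => y; exact: fg.
Qed.

Lemma box_supported_partial f i : box_supported f -> box_supported (partial i f).
Proof.
move=> [delta [rho [d0 bf]]]; exists delta, rho; split => // x x0.
apply: contra_neqP => nB.
rewrite /partial (@near_eq_derive _ _ _ f (cst 0)) ?derive_cst//.
have : nbhs x (H `&` ~` box delta rho).
  apply: open_nbhs_nbhs; split => //; apply: openI; first exact: open_half_space.
  by apply: closed_openC; exact: closed_box.
apply: filterS => y [y0 ny]; apply/eqP/negPn; apply/negP => fy.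
by apply: ny; exact: bf.
Qed.

Lemma box_supported_bounded f : (forall x, H x -> {for x, continuous f}) ->
  box_supported f -> exists2 M, 0 < M & forall x, H x -> `|f x| <= M.
Proof.
move=> cf [delta [rho [d0 bf]]].
have [M M0 HM] := continuous_bounded_on (@compact_box delta rho)
  (fun x bx => cf x (box_sub d0 bx)).
exists M => // x x0; have [->|fx] := eqVneq (f x) 0; first by rewrite normr0 ltW.
exact/HM/bf.
Qed.

(** Smooth functions with compact support in the half space; unlike
smooth_compact_hyp, the support condition is explicit. *)
Definition test_function f := smooth_hyp f /\ box_supported f.

Lemma test_function_partial f i : test_function f -> test_function (partial i f).
Proof. by move=> [sf bf]; split; [exact: smooth_partial|exact: box_supported_partial]. Qed.

Lemma test_function_continuous f x : test_function f -> H x -> {for x, continuous f}.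
Proof. by move=> [sf _] x0; case: (sf [::] x x0). Qed.

Lemma test_function_derivable f x i : test_function f -> H x -> derivable f x (delta_mx 0 i).
Proof. by move=> [sf _] x0; case: (sf [::] x x0). Qed.

Lemma test_function_bounded f : test_function f ->
  exists2 M, 0 < M & forall x, H x -> `|f x| <= M.
Proof.
by move=> tf; apply: box_supported_bounded tf.2 => x; exact: test_function_continuous.
Qed.

Lemma test_function_grad_bounded f : test_function f ->
  exists2 M, 0 < M & forall i x, H x -> `|partial i f x| <= M.
Proof.
move=> tf.
have /choice[M HM] : forall i, exists M, 0 < M /\ forall x, H x -> `|partial i f x| <= M.
  by move=> i; have [M M0 HM] := test_function_bounded (test_function_partial i tf); exists M.
exists (1 + \sum_i M i).
  by rewrite ltr_pwDl// sumr_ge0// => i _; rewrite ltW//; case: (HM i).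
move=> i x x0; have [_ /(_ x x0)/le_trans] := HM i; apply.
rewrite (bigD1 i)//= addrCA lerDl addr_ge0// sumr_ge0// => j _.
by rewrite ltW//; case: (HM j).
Qed.

Lemma test_function_measurable f : test_function f ->
  measurable_fun H (f : _ -> measurableTypeR R).
Proof.
move=> tf; apply: continuous_measurable_rV; first exact: open_half_space.
by move=> x; exact: test_function_continuous.
Qed.

End test_functions.

(** * Differentiation under the integral over the cube *)

Section under_integral.
Variables (R : realType) (n : nat).
Local Notation m := n.+1.
Local Notation H := (@half_space R n).
Local Notation Q := (@unit_cube R m).
Local Notation leb := (lebesgue_rV R m).
Implicit Types (x y z t : 'rV[R]_m) (f g q : 'rV[R]_m -> R).

(** Weights allowed in an average: measurable, and bounded on the cube. *)
Definition weight q := measurable_fun setT (q : _ -> measurableTypeR R) /\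
  exists M, forall t, Q t -> `|q t| <= M.

Lemma bounded_integrable_cube g M : measurable_fun Q (g : _ -> measurableTypeR R) ->
  (forall t, Q t -> `|g t| <= M) -> leb.-integrable Q (EFin \o g).
Proof.
move=> mg bg.
have Q1 : (leb Q < +oo)%E by rewrite lebesgue_unit_cube ltry.
apply: measurable_bounded_integrable => //.
- exact: measurable_unit_cube.
- exists M; split; first exact: num_real.
  by move=> y My t Qt; apply: le_trans (ltW My); exact: bg.
Qed.

Lemma measurable_comp_cube f (gam : 'rV[R]_m -> 'rV[R]_m) :
  measurable_fun H (f : _ -> measurableTypeR R) -> measurable_fun setT gam ->
  (forall t, Q t -> H (gam t)) ->
  measurable_fun Q ((fun t => f (gam t)) : _ -> measurableTypeR R).
Proof.
move=> mf mg QH; apply: (measurable_comp (@measurable_half_space R n) _ mf).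
  by move=> _ [t Qt <-]; exact: QH.
exact: measurable_funTS.
Qed.

Lemma weight_integrable f q (gam : 'rV[R]_m -> 'rV[R]_m) :
  test_function f -> weight q -> measurable_fun setT gam ->
  (forall t, Q t -> H (gam t)) ->
  leb.-integrable Q (EFin \o (fun t => q t * f (gam t))).
Proof.
move=> tf [mq [Mq qM]] mg QH; have [M M0 fM] := test_function_bounded tf.
apply: (@bounded_integrable_cube _ (Mq * M)).
  apply: measurable_funM; first exact: measurable_funTS.
  by apply: measurable_comp_cube => //; exact: test_function_measurable.
by move=> t Qt; rewrite normrM ler_pM//; [exact: qM|exact/fM/QH].
Qed.

(** Differentiation of a weighted integral of f along a family of curves whose
velocities are bounded uniformly on the cube. *)
Lemma is_derive_integral_cube f q (gam dgam : R -> 'rV[R]_m -> 'rV[R]_m)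
    (u v s0 B : R) :
  test_function f -> weight q -> u < s0 < v ->
  (forall s, u < s < v -> measurable_fun setT (gam s)) ->
  (forall s t, u < s < v -> Q t -> H (gam s t)) ->
  (forall s t i, u < s < v -> Q t ->
     is_derive s (1 : R) (fun s => gam s t 0 i) (dgam s t 0 i)) ->
  (forall s t i, u < s < v -> Q t -> `|dgam s t 0 i| <= B) ->
  is_derive s0 (1 : R) (fun s => \int[leb]_(t in Q) (q t * f (gam s t)))
   (\int[leb]_(t in Q) (q t * \sum_(i < m) partial i f (gam s0 t) * dgam s0 t 0 i)).
Proof.
move=> tf wq uv mg QH dg dB.
have [M M0 fM] := test_function_grad_bounded tf.
have [mq [Mq qM]] := wq.
have dcurve s t : u < s < v -> Q t -> is_derive s (1 : R) (fun s => q t * f (gam s t))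
   (q t * \sum_(i < m) partial i f (gam s t) * dgam s t 0 i).
  move=> suv Qt; apply: (@is_deriveZ _ _ _ (fun s => f (gam s t)) (q t)).
  apply: (@is_derive_curve _ _ f (fun s => gam s t)) => //.
  - by move=> x x0 i; exact: test_function_derivable.
  - exact: QH.
  - by move=> i; apply: test_function_continuous; [exact: test_function_partial|exact: QH].
  - by move=> i; exact: dg.
have Id1 s t : u < s < v -> Q t -> partial1of2 (fun s t => q t * f (gam s t)) s t =
   q t * \sum_(i < m) partial i f (gam s t) * dgam s t 0 i.
  by move=> suv Qt; rewrite partial1of2E; have [_] := dcurve s t suv Qt.
have Iuv : [set` `]u, v[] s0 by rewrite /= in_itv.
have Huv s : [set` `]u, v[] s -> u < s < v by rewrite /= in_itv.
have Iint s : [set` `]u, v[] s -> leb.-integrable Q (EFin \o (fun t => q t * f (gam s t))).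
  by move=> /Huv suv; apply: weight_integrable => //; [exact: mg|move=> t; exact: QH].
pose c : R := Mq * \sum_(i < m) M * B.
have Ider s t : [set` `]u, v[] s -> Q t -> derivable (fun s => q t * f (gam s t)) s 1.
  by move=> /Huv suv Qt; have [] := dcurve s t suv Qt.
have IG s t : [set` `]u, v[] s -> Q t -> `|partial1of2 (fun s t => q t * f (gam s t)) s t| <= `|c|.
  move=> /Huv suv Qt; rewrite Id1// normrM /c.
  apply: le_trans (ler_norm _); apply: ler_pM => //; first exact: qM.
  apply: le_trans (ler_norm_sum _ _ _) _; apply: ler_sum => i _.
  rewrite normrM; apply: ler_pM => //; [exact/fM/QH|exact: dB].
have intG : leb.-integrable Q (EFin \o (fun t => `|c|)).
  apply: (@bounded_integrable_cube (fun=> `|c|) `|c|); first exact: measurable_cst.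
  by move=> t _; rewrite normr_id.
apply: DeriveDef.
  exact: (@derivable_under_integral R _ _ leb (fun s t => q t * f (gam s t)) Q
    (@measurable_unit_cube R m) s0 u v Iuv Iint Ider (fun=> `|c|) (fun _ => normr_ge0 c) intG IG).
rewrite -derive1E.
rewrite (@differentiation_under_integral R _ _ leb (fun s t => q t * f (gam s t)) Q
    (@measurable_unit_cube R m) s0 u v Iuv Iint Ider (fun=> `|c|) (fun _ => normr_ge0 c) intG IG).
by apply: eq_Rintegral => t; rewrite inE => Qt; exact: Id1.
Qed.

End under_integral.

(** * The averaging operator *)

Lemma jac_const_bounds (R : realType) (r a : R) : 0 < r -> 0 <= a ->
  [/\ 1 <= 1 + r + a, 0 <= 1 + r + a, a <= 1 + r + a, r <= 1 + r + a & r <= r + a].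
Proof. by move=> r0 a0; split; lra. Qed.

Section averaging.
Variables (R : realType) (n : nat) (r : R).
Hypothesis r0 : 0 < r.
Local Notation m := n.+1.
Local Notation H := (@half_space R n).
Local Notation Q := (@unit_cube R m).
Local Notation leb := (lebesgue_rV R m).
Implicit Types (x y z t : 'rV[R]_m) (f g q F : 'rV[R]_m -> R).

(** The average of f over the cube of size r at x, with weight q. *)
Definition avg q f x : R := \int[leb]_(t in Q) (q t * f (flow r 0 x t)).

(** The derivative with respect to x_j of the i-th coordinate of flow r 0 x t.
It does not depend on x, because flow is linear in x. *)
Definition flow_jac (j i : 'I_m) t : R :=
  if j == ord_max then (if i == ord_max then expR (r * t 0 i - 0) else r * t 0 i)
  else (i == j)%:R.

(** Moving x along a coordinate moves flow r 0 x t affinely. *)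
Lemma flow_line x j s t i :
  flow r 0 (x + s *: delta_mx 0 j) t 0 i = flow r 0 x t 0 i + flow_jac j i t * s.
Proof.
rewrite !flowE /flow_coord /flow_jac /height !mxE /=.
have [->|jm] := eqVneq j ord_max.
  by rewrite ?eqxx ?mulr1; case: eqP => [->|/eqP im]; rewrite ?eqxx ?(negbTE im) /=; ring.
rewrite ?[ord_max == j]eq_sym ?(negbTE jm); case: eqP => [->|/eqP im] /=;
  by rewrite ?[ord_max == j]eq_sym ?(negbTE jm)/=; ring.
Qed.

Lemma flow_jac_bound j i t : Q t -> `|flow_jac j i t| <= 1 + r + expR r.
Proof.
move=> Qt; have /andP[t0 t1] := Qt i.
have [b1 b2 b3 b4 b5] := jac_const_bounds r0 (expR_ge0 r).
rewrite /flow_jac; case: ifP => _; last first.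
  by case: (i == j); rewrite ?normr1 ?normr0.
case: ifP => _.
  rewrite ger0_norm ?expR_ge0// subr0; apply: le_trans b3.
  by rewrite ler_expR ler_piMr// ltW.
rewrite ger0_norm; last by rewrite mulr_ge0 ?ltW.
by apply: le_trans b4; rewrite ler_piMr// ltW.
Qed.

Lemma measurable_flow_jac j i : measurable_fun setT (flow_jac j i : _ -> measurableTypeR R).
Proof.
have mt : measurable_fun setT ((fun t : 'rV[R]_m => r * t 0 i) : _ -> measurableTypeR R).
  apply: measurable_funM => //.
  exact: (@measurable_coord _ (measurableTypeR R) 1 m ord0 i).
rewrite (_ : flow_jac j i = fun t => if j == ord_max then (if i == ord_max then expR (r * t 0 i - 0) else r * t 0 i)
  else (i == j)%:R)//.
case: (j == ord_max) => //; case: (i == ord_max) => //.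
apply: (measurableT_comp (@measurable_expR R)).
by apply: measurable_funB.
Qed.

Lemma weight_jac q j i : weight q -> weight (fun t => q t * flow_jac j i t).
Proof.
move=> [mq [M qM]]; split.
  by apply: measurable_funM => //; exact: measurable_flow_jac.
exists (M * (1 + r + expR r)) => t Qt.
by rewrite normrM ler_pM// ?flow_jac_bound//; exact: qM.
Qed.

Lemma avg_integrable q f x : weight q -> test_function f -> H x ->
  leb.-integrable Q (EFin \o (fun t => q t * f (flow r 0 x t))).
Proof.
move=> wq tf x0; apply: weight_integrable => //; first exact: measurable_flow.
by move=> t _; exact: half_space_flow.
Qed.

Lemma half_space_line x j s : H x -> - height x < s < height x ->
  H (x + s *: delta_mx 0 j).
Proof.
move=> x0; have {}x0 : 0 < height x by [].
move=> /andP[s1 s2]; rewrite /half_space /height /= !mxE /= -/(height x).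
by case: eqP => _ /=; rewrite ?mulr1 ?mulr0; lra.
Qed.

Lemma is_derive_of_line f x (v : 'rV[R]_m) (df : R) :
  is_derive 0 (1 : R) (fun s : R => f (x + s *: v)) df -> is_derive x v f df.
Proof.
have E : (fun h : R => h^-1 *: (((fun s => f (x + s *: v)) \o shift 0) (h *: (1 : R)) - f (x + 0 *: v))) =
  (fun h : R => h^-1 *: ((f \o shift x) (h *: v) - f x)).
  apply/funext => h /=; rewrite scale0r !addr0; congr (_ *: (f _ - _)).
  by rewrite [h *: 1]mulr1 addrC.
by case; rewrite /derivable /derive E => d1 d2; apply: DeriveDef.
Qed.

Lemma is_derive_avg q f x j : weight q -> test_function f -> H x ->
  is_derive x (delta_mx 0 j) (avg q f)
   (\int[leb]_(t in Q) (q t * \sum_(i < m) partial i f (flow r 0 x t) * flow_jac j i t)).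
Proof.
move=> wq tf x0; apply: is_derive_of_line.
have hx : 0 < height x by [].
have := @is_derive_integral_cube R n f q (fun s t => flow r 0 (x + s *: delta_mx 0 j) t)
  (fun s t => \row_i flow_jac j i t) (- height x) (height x) 0 (1 + r + expR r) tf wq.
rewrite scale0r addr0 => D; apply: (is_derive_eq (D _ _ _ _ _)).
- by rewrite hx oppr_lt0 hx.
- by move=> s _; exact: measurable_flow.
- by move=> s t sx _; apply: half_space_flow; exact: half_space_line.
- move=> s t i _ _; rewrite mxE.
  rewrite (_ : (fun _ => _) = (fun s => flow r 0 x t 0 i + flow_jac j i t * s)).
    exact: is_derive_affine.
  by apply/funext => s'; exact: flow_line.
- by move=> s t i _ Qt; rewrite mxE flow_jac_bound.
by apply: eq_Rintegral => t _; congr (_ * _); apply: eq_bigr => i _; rewrite mxE.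
Qed.

Lemma Rintegral_cube_cst (c : R) : \int[leb]_(t in Q) c = c.
Proof.
rewrite Rintegral_cst; last exact: measurable_unit_cube.
by transitivity (c * fine (leb Q)) => //; rewrite lebesgue_unit_cube mulr1.
Qed.

Lemma Rintegral_sum_cube (I : Type) (s : seq I) (h : I -> 'rV[R]_m -> R) :
  (forall i, leb.-integrable Q (EFin \o h i)) ->
  \int[leb]_(t in Q) (\sum_(i <- s) h i t) = \sum_(i <- s) \int[leb]_(t in Q) h i t.
Proof.
move=> ih; elim: s => [|i s IH].
  rewrite big_nil; under eq_Rintegral do rewrite big_nil.
  by rewrite /Rintegral integral0.
rewrite big_cons -IH -RintegralD//.
- by apply: eq_Rintegral => t _; rewrite big_cons.
- exact: measurable_unit_cube.
- rewrite (_ : EFin \o _ = (fun t => \sum_(j <- s) (EFin \o h j) t)%E).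
    by apply: integrable_sum => //; exact: measurable_unit_cube.
  by apply/funext => t /=; rewrite sumEFin.
Qed.

Lemma partial_avg q f x j : weight q -> test_function f -> H x ->
  partial j (avg q f) x =
  \sum_(i < m) avg (fun t => q t * flow_jac j i t) (partial i f) x.
Proof.
move=> wq tf x0; have [_ E] := is_derive_avg j wq tf x0.
rewrite /partial E -Rintegral_sum_cube.
  by apply: eq_Rintegral => t _; rewrite mulr_sumr; apply: eq_bigr => i _; rewrite -[RHS]mulrA; congr (_ * _); exact: mulrC.
move=> i; exact: (avg_integrable (weight_jac j i wq) (test_function_partial i tf) x0).
Qed.

Lemma flow_lip x y t i : Q t ->
  `|flow r 0 y t 0 i - flow r 0 x t 0 i| <= (1 + r + expR r) * `|y - x|.
Proof.
move=> Qt; have /andP[t0 t1] := Qt i.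
have hxy j : `|y 0 j - x 0 j| <= `|y - x|.
  by have := ler_coord_norm (y - x) j; rewrite !mxE.
have [b1 b2 b3 b4 b5] := jac_const_bounds r0 (expR_ge0 r).
rewrite !flowE /flow_coord /height; case: ifP => _.
  rewrite -mulrBl normrM mulrC subr0 (ger0_norm (expR_ge0 _)).
  apply: ler_pM; rewrite ?expR_ge0 ?hxy//.
  by apply: le_trans b3; rewrite ler_expR ler_piMr// ltW.
rewrite (_ : _ - _ = (y 0 i - x 0 i) + r * t 0 i * (y 0 ord_max - x 0 ord_max)); last by ring.
apply: le_trans (ler_normD _ _) _; rewrite normrM (@ger0_norm _ (r * t 0 i)); last by rewrite mulr_ge0 ?ltW.
rewrite -addrA mulrDl mul1r lerD//.
apply: ler_pM => //; first by rewrite mulr_ge0 ?ltW.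
by apply: le_trans b5; rewrite ler_piMr// ltW.
Qed.

(** Test functions are Lipschitz, and flow r 0 x t is Lipschitz in x uniformly in
t, so averages are Lipschitz. *)
Lemma continuous_avg q f x : weight q -> test_function f -> H x ->
  {for x, continuous (avg q f)}.
Proof.
move=> wq tf x0; have [M M0 fM] := test_function_grad_bounded tf.
have [mq [Mq' qM']] := wq; pose Mq := `|Mq'| + 1.
have Mq0 : 0 < Mq by rewrite ltr_pwDr.
have qM t : Q t -> `|q t| <= Mq.
  by move=> Qt; apply: le_trans (qM' t Qt) _; rewrite /Mq ler_wpDr// ler_norm.
pose L := 1 + r + expR r.
have L0 : 0 < L by rewrite /L addr_gt0 ?expR_gt0// addr_gt0.
pose C := Mq * (M * (m%:R * L)).
have C0 : 0 < C by rewrite !mulr_gt0.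
have lip y : H y -> `|avg q f x - avg q f y| <= C * `|x - y|.
  move=> y0; rewrite /avg -RintegralB; last 3 first.
  - exact: measurable_unit_cube.
  - exact: avg_integrable.
  - exact: avg_integrable.
  have iB : leb.-integrable Q (EFin \o (fun t => q t * f (flow r 0 x t) - q t * f (flow r 0 y t))).
    have := integrableB (@measurable_unit_cube R m) (avg_integrable wq tf x0) (avg_integrable wq tf y0).
    by congr (integrable _ _ _); apply/funext.
  have mQ := @measurable_unit_cube R m.
  apply: le_trans (le_normr_Rintegral mQ iB) _.
  have icst : leb.-integrable Q (EFin \o (fun=> C * `|x - y|)).
    apply: (@bounded_integrable_cube _ _ (fun=> C * `|x - y|) (C * `|x - y|)); first exact: measurable_cst.
    by move=> t _; rewrite ger0_norm// mulr_ge0// ltW.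
  apply: (@le_trans _ _ (\int[leb]_(t in Q) (C * `|x - y|))).
    apply: le_Rintegral => //; first exact: integrable_norm.
    move=> t Qt; rewrite -mulrBr normrM /C -mulrA ler_pM// ?qM//.
    apply: le_trans (lipschitz_half_space (M := M) _ _ _ _) _ => //.
    - by move=> z z0 i; exact: test_function_derivable.
    - exact: half_space_flow.
    - exact: half_space_flow.
    rewrite -mulrA ler_wpM2l ?(ltW M0)//.
    apply: le_trans (ler_sum _ _) _; first by move=> i _; exact: flow_lip.
    by rewrite sumr_const card_ord -[leLHS]mulr_natl mulrA.
  by rewrite Rintegral_cube_cst.
suff : avg q f y @[y --> x] --> avg q f x by [].
apply/(@cvgrPdist_le _ _ _ (nbhs x)) => e e0.
have nH : \forall y \near x, H y := open_nbhs_nbhs (conj (@open_half_space R n) x0).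
have nd : \forall y \near x, `|x - y| <= e / C.
  have eC : 0 < e / C by rewrite divr_gt0.
  exact: (@cvgr_dist_le _ _ _ (nbhs x) _ id x cvg_id _ eC).
apply: (@filterS _ (nbhs x) _ _ _ _ (filterI nH nd)) => y [y0 yd].
by apply: le_trans (lip y y0) _; rewrite mulrC -ler_pdivlMr.
Qed.

(** Functions equal, on the half space, to a finite sum of weighted averages of
test functions.  This class is stable under partial derivatives, which makes
its members smooth. *)
Inductive avg_span : ('rV[R]_m -> R) -> Prop :=
| Span_avg q f F : weight q -> test_function f ->
   (forall x, H x -> F x = avg q f x) -> avg_span F
| Span_add F1 F2 F : avg_span F1 -> avg_span F2 ->
   (forall x, H x -> F x = F1 x + F2 x) -> avg_span F
| Span0 F : (forall x, H x -> F x = 0) -> avg_span F.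

Lemma near_half_space F G x : H x -> (forall y, H y -> F y = G y) -> \near x, F x = G x.
Proof.
move=> x0 FG; have := open_nbhs_nbhs (conj (@open_half_space R n) x0).
by apply: filterS => y; exact: FG.
Qed.

Lemma eq_continuous_half_space F G x : H x -> (forall y, H y -> F y = G y) ->
  {for x, continuous G} -> {for x, continuous F}.
Proof.
move=> x0 FG cG; rewrite /prop_for /continuous_at (FG x x0).
have FG' y : H y -> G y = F y by move=> y0; rewrite FG.
exact: (cvg_trans (@near_eq_cvg _ _ (nbhs x) _ G F (near_half_space x0 FG')) cG).
Qed.

Lemma eq_derivable_half_space F G x v : H x -> (forall y, H y -> F y = G y) ->
  derivable G x v -> derivable F x v.
Proof.
move=> x0 FG; apply: near_eq_derivable.
by apply: (@near_half_space G F) => // y y0; rewrite FG.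
Qed.

Lemma avg_span_derivable F : avg_span F ->
  (forall x, H x -> {for x, continuous F} /\ forall j, derivable F x (delta_mx 0 j)) /\
  forall j, avg_span (partial j F).
Proof.
elim=> {F} [q f F wq tf FE|F1 F2 F _ [d1 s1] _ [d2 s2] FE|F FE]; split.
- move=> x x0; split.
    exact: (eq_continuous_half_space x0 FE (continuous_avg wq tf x0)).
  move=> j; apply: (eq_derivable_half_space x0 FE).
  by have [] := is_derive_avg j wq tf x0.
- move=> j.
  have : avg_span (fun x => \sum_(i <- enum 'I_m) avg (fun t => q t * flow_jac j i t) (partial i f) x).
    elim: (enum 'I_m) => [|i s IH]; first by apply: Span0 => x _; rewrite big_nil.
    apply: (@Span_add (avg (fun t => q t * flow_jac j i t) (partial i f)) _ _ _ IH).
      apply: (@Span_avg (fun t => q t * flow_jac j i t) (partial i f)) => //; first exact: weight_jac.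
      exact: test_function_partial.
    by move=> x _; rewrite big_cons.
  move=> S; apply: (Span_add S (Span0 (F := fun=> 0) (fun _ _ => erefl))) => x x0.
  by rewrite addr0 (near_eq_partial j x0 FE) partial_avg// big_enum.
- move=> x x0; have [c1 e1] := d1 x x0; have [c2 e2] := d2 x x0; split.
    by apply: (eq_continuous_half_space x0 FE); exact: (@continuousD _ _ _ F1 F2 x c1 c2).
  by move=> j; apply: (eq_derivable_half_space x0 FE); apply: (@derivableD _ _ _ F1 F2); [exact: e1|exact: e2].
- move=> j; apply: (Span_add (s1 j) (s2 j)) => x x0.
  rewrite (near_eq_partial j x0 FE) /partial.
  by apply: (@deriveD _ _ _ F1 F2); [case: (d1 x x0)|case: (d2 x x0)].
- move=> x x0; split.
    by apply: (eq_continuous_half_space x0 (G := fun=> 0) FE); exact: cst_continuous.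
  by move=> j; apply: (eq_derivable_half_space x0 (G := cst 0) FE); exact: derivable_cst.
- move=> j; apply: Span0 => x x0.
  by rewrite (@near_eq_partial _ _ _ (cst 0) j x x0 FE) /partial derive_cst.
Qed.

Lemma avg_span_smooth F : avg_span F -> smooth_hyp F.
Proof.
move=> S s; elim/last_ind: s F S => [|s j IH] F S x x0.
  by have [] := avg_span_derivable S; move=> /(_ x x0).
by rewrite foldr_rcons; apply: IH => //; have [_] := avg_span_derivable S.
Qed.

Lemma avg_test_function f : test_function f -> test_function (avg (fun=> 1) f).
Proof.
move=> tf; have w1 : weight (fun=> 1 : R).
  by split => //; exists 1 => t _; rewrite normr1.
split; first by apply: avg_span_smooth; apply: (@Span_avg (fun=> 1) f) => //.
have [_ [delta [rho [d0 bf]]]] := tf.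
exists (delta * expR (- r)), (rho + r * rho); split; first by rewrite mulr_gt0 ?expR_gt0.
move=> x x0 ax.
have [t Qt ft] : exists2 t, Q t & f (flow r 0 x t) != 0.
  apply: contrapT => nt; move/eqP: ax; apply.
  rewrite /avg (@eq_Rintegral _ _ _ leb Q (cst 0)).
    by rewrite /Rintegral integral0.
  move=> t; rewrite inE => Qt; rewrite mul1r; apply/eqP/negPn/negP => ft.
  by apply: nt; exists t.
have [h1 h2] := bf _ (half_space_flow r 0 t x0) ft.
have hx : 0 < height x by [].
have /andP[tm0 tm1] := Qt ord_max.
have rt0 : 0 <= r * height t by rewrite mulr_ge0 ?ltW.
have rt1 : r * height t <= r by rewrite ler_piMr// ltW.
have hx1 : height x <= height (flow r 0 x t).
  by rewrite height_flow ler_peMr ?(ltW hx)// subr0 -expR0 ler_expR.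
have hrho : height x <= rho.
  by apply: le_trans hx1 _; apply: le_trans (h2 ord_max); exact: ler_norm.
have rho0 : 0 <= rho by apply: le_trans hrho; exact: ltW.
split.
  rewrite expRN ler_pdivrMr ?expR_gt0//; apply: le_trans h1 _.
  by rewrite height_flow ler_pM2l// subr0 ler_expR.
move=> i; have [->|im] := eqVneq i ord_max.
  rewrite -/(height x) gtr0_norm//; apply: le_trans hrho _.
  by rewrite ler_wpDr// mulr_ge0// ltW.
have := h2 i; rewrite flowE /flow_coord (negbTE im) => h2i.
have /andP[ti0 ti1] := Qt i.
rewrite (_ : x 0 i = (x 0 i + r * height x * t 0 i) - r * height x * t 0 i); last by ring.
apply: le_trans (ler_normB _ _) _; apply: lerD => //.
rewrite ger0_norm; last by rewrite !mulr_ge0 ?ltW.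
rewrite -mulrA; apply: ler_pM => //; first exact: ltW.
  by rewrite mulr_ge0 ?ltW.
by apply: le_trans hrho; rewrite ler_piMr// ltW.
Qed.

End averaging.

(** * The gradient norm and its averages *)

Section gradient_norm.
Variables (R : realType) (n : nat).
Local Notation m := n.+1.
Local Notation H := (@half_space R n).
Local Notation Q := (@unit_cube R m).
Local Notation leb := (lebesgue_rV R m).
Implicit Types (x y z t : 'rV[R]_m) (f g q : 'rV[R]_m -> R).

Lemma hyp_grad_norm_ge0 f x : 0 <= hyp_grad_norm f x.
Proof. exact: sqrtr_ge0. Qed.

Lemma partial_le_grad_norm f x i : H x ->
  height x * `|partial i f x| <= hyp_grad_norm f x.
Proof.
move=> x0; rewrite hyp_grad_normE// ler_pM2l//.
rewrite -sqrtr_sqr ler_sqrt; last by rewrite sumr_ge0// => j _; rewrite sqr_ge0.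
by rewrite (bigD1 i)//= lerDl sumr_ge0// => j _; rewrite sqr_ge0.
Qed.

Lemma grad_norm_le_partials f x : H x ->
  hyp_grad_norm f x <= \sum_(i < m) height x * `|partial i f x|.
Proof.
move=> x0; have hx : 0 < height x by [].
rewrite hyp_grad_normE// -mulr_sumr ler_pM2l//.
have S0 : 0 <= \sum_(i < m) `|partial i f x| by rewrite sumr_ge0.
rewrite -[leRHS]ger0_norm// -sqrtr_sqr ler_sqrt ?sqr_ge0//.
rewrite expr2 mulr_suml; apply: ler_sum => i _.
rewrite -real_normK ?num_real// expr2 ler_wpM2l//.
by rewrite (bigD1 i)//= lerDl sumr_ge0.
Qed.

Lemma measurable_hyp_grad_norm f : test_function f ->
  measurable_fun H (hyp_grad_norm f : _ -> measurableTypeR R).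
Proof.
move=> tf.
apply: (@eq_measurable_fun _ _ _ _ _ (fun x => height x * Num.sqrt (\sum_(i < m) partial i f x ^+ 2))).
  by move=> x; rewrite inE => x0; rewrite hyp_grad_normE.
apply: measurable_funM; first by apply: measurable_funTS; exact: measurable_height.
apply: (@measurableT_comp _ _ _ _ _ _ (@Num.sqrt R : measurableTypeR R -> measurableTypeR R)).
  by apply: continuous_measurable_fun; exact: sqrt_continuous.
apply: measurable_sum => i; apply: measurable_funX.
apply: test_function_measurable; exact: test_function_partial.
Qed.

Lemma le_Lnorm_hypy f (M : R) : 0 <= M -> (forall x, H x -> `|f x| <= M) ->
  (Lnorm_hyp +oo f <= M%:E)%E.
Proof.
move=> M0 fM; rewrite /Lnorm_hyp unlock; case: ifP => _; last by rewrite lee_fin.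
apply/ess_supP; apply: aeW => x /=.
rewrite patchE; case: ifPn => [|_]; last by rewrite abse0 lee_fin.
by rewrite inE => x0; rewrite lee_fin; exact: fM.
Qed.

Local Open Scope ereal_scope.

(** Hoelder's inequality against the constant function 1 on the cube, followed by
the change of variables. *)
Lemma cube_average_grad_le f (p r tau : R) x : test_function f -> (1 < p)%R -> (0 < r)%R -> H x ->
  \int[leb]_(t in Q) (hyp_grad_norm f (flow r tau x t))%:E <=
  ((r ^- m * expR (n%:R * (r - tau))) `^ (p^-1))%:E * Lnorm_hyp p%:E (hyp_grad_norm f).
Proof.
move=> tf p1 r0 x0.
have p0 : (0 < p)%R by rewrite (lt_trans ltr01).
set c := (r ^- m * _)%R.
have c0 : (0 <= c)%R by rewrite mulr_ge0 ?expR_ge0 // invr_ge0 exprn_ge0 ?ltW.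
pose gn := hyp_grad_norm f.
pose f1 := (fun t => gn (flow r tau x t)) \_ Q.
have mQ := @measurable_unit_cube R m.
have mf1 : measurable_fun setT (f1 : _ -> measurableTypeR R).
  apply/(measurable_restrictT _ _).1 => //; apply: measurable_comp_cube.
  - exact: measurable_hyp_grad_norm.
  - exact: measurable_flow.
  - by move=> t _; exact: half_space_flow.
pose f2 : 'rV[R]_m -> R := \1_Q.
have mf2 : measurable_fun setT (f2 : _ -> measurableTypeR R).
  exact: measurable_indic.
pose q := (p / (p - 1))%R.
have q0 : (0 < q)%R by rewrite divr_gt0// subr_gt0.
have pq : (p^-1 + q^-1 = 1)%R.
  rewrite /q invfM invrK; have := p0; have : (p != 0)%R by rewrite gt_eqF.
  by move=> pn _; field.
have := hoelder leb mf1 mf2 p0 q0 pq.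
have -> : ('N[leb]_q%:E[EFin \o f2] = 1)%E.
  rewrite unlock (_ : \int[leb]_t _ = \int[leb]_(t in Q) 1).
    rewrite integral_cst; last exact: mQ.
    by rewrite mul1e; transitivity (leb Q `^ q^-1) => //; rewrite lebesgue_unit_cube poweR1r.
  rewrite [RHS]integral_mkcond; apply: eq_integral => t _.
  rewrite patchE /f2 /= indicE; case: ifP => _ /=; first by rewrite normr1 powR1.
  by rewrite normr0 powR0// gt_eqF.
rewrite mule1 Lnorm1 => h1.
rewrite [leLHS](_ : _ = \int[leb]_t `|(EFin \o (f1 \* f2)%R) t|); last first.
  rewrite integral_mkcond; apply: eq_integral => t _.
  rewrite /f1 /f2/= !patchE indicE; case: ifP => _ /=; last by rewrite mul0r normr0.
  by rewrite mulr1 ger0_norm// hyp_grad_norm_ge0.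
apply: le_trans h1 _.
pose u y := `| ((EFin \o gn) \_ H) y | `^ p.
have mu_ : measurable_fun setT u.
  apply: (measurableT_comp (measurable_poweR p)).
  apply: measurableT_comp => //.
  apply/(measurable_restrictT _ _).1 => //; first exact: measurable_half_space.
  by apply/measurable_EFinP; exact: measurable_hyp_grad_norm.
have u0 y : 0 <= u y by exact: poweR_ge0.
rewrite /Lnorm_hyp !unlock -/u.
rewrite -poweR_EFin -poweRM; last 2 first.
- by rewrite lee_fin.
- by apply: integral_ge0 => y _; exact: poweR_ge0.
apply: gt0_ler_poweR.
- by rewrite invr_ge0 ltW.
- by rewrite in_itv/= leey andbT; apply: integral_ge0 => t _; rewrite lee_fin powR_ge0.
- by rewrite in_itv/= leey andbT; rewrite mule_ge0 ?lee_fin//; apply: integral_ge0 => y _; case: (patch _ _ _ _) => [s||] /=; rewrite ?lee_fin ?powR_ge0 //; case: ifP.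
apply: le_trans (integral_flow_le tau r0 x0 mu_ u0).
rewrite [leRHS]integral_mkcond le_eqVlt; apply/orP; left; apply/eqP.
apply: eq_integral => t _.
rewrite /u /f1/= !patchE; case: ifP => _ /=; last by rewrite normr0 powR0// gt_eqF.
by rewrite mem_set//; exact: half_space_flow.
Qed.

End gradient_norm.

(** * Bounds for the averages *)

(** If |F'| <= K' then the increment of F is at most that of K. *)
Lemma ler_dist_derive (R : realType) (F K dF dK : R -> R) (a b : R) : a <= b ->
  (forall s, a <= s <= b -> is_derive s (1 : R) F (dF s)) ->
  (forall s, a <= s <= b -> is_derive s (1 : R) K (dK s)) ->
  (forall s, a <= s <= b -> `|dF s| <= dK s) -> `|F b - F a| <= K b - K a.
Proof.
move=> ab dFs dKs FK.
have mono (G dG : R -> R) : (forall s, a <= s <= b -> is_derive s (1 : R) G (dG s)) ->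
    (forall s, a <= s <= b -> 0 <= dG s) -> 0 <= G b - G a.
  move=> GD G0; have [||c] := @MVT_segment R G dG a b ab.
  - by move=> s; rewrite in_itv/= => /andP[s1 s2]; apply: GD; rewrite !ltW.
  - apply: derivable_within_continuous => s; rewrite in_itv/= => sab.
    by case: (GD s sab).
  by rewrite in_itv/= => cab ->; rewrite mulr_ge0 ?subr_ge0// G0.
have h1 : 0 <= (K b - F b) - (K a - F a).
  apply: (mono (K - F) (dK - dF)) => s sab.
    by apply: is_deriveB; [exact: dKs|exact: dFs].
  by rewrite subr_ge0; have := FK s sab; rewrite ler_norml => /andP[].
have h2 : 0 <= (K b + F b) - (K a + F a).
  apply: (mono (K + F) (dK + dF)) => s sab.
    by apply: is_deriveD; [exact: dKs|exact: dFs].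
  by have := FK s sab; rewrite ler_norml => /andP[+ _]; rewrite -subr_ge0 opprK addrC.
rewrite ler_norml; apply/andP; split; lra.
Qed.

Section bounds.
Variables (R : realType) (n : nat) (p g : R).
Local Notation m := n.+1.
Local Notation H := (@half_space R n).
Local Notation Q := (@unit_cube R m).
Local Notation leb := (lebesgue_rV R m).
Hypothesis pm : m%:R < p.
Implicit Types (x y z t : 'rV[R]_m).
Variable f : 'rV[R]_m -> R.
Hypothesis tf : test_function f.
Hypothesis Gg : Lnorm_hyp p%:E (hyp_grad_norm f) = g%:E.

Let p1 : 1 < p.
Proof. by apply: le_lt_trans pm; rewrite ler1n. Qed.

Let p0 : 0 < p.
Proof. exact: lt_trans ltr01 p1. Qed.

Let g0 : 0 <= g.
Proof. by rewrite -lee_fin -Gg; exact: Lnorm_ge0. Qed.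

(** The constant of cube_average_grad_le. *)
Definition average_const (r tau : R) := (r ^- m * expR (n%:R * (r - tau))) `^ (p^-1).

(** The form in which cube_average_grad_le is used: an integrand dominated by a
multiple of the gradient norm along the flow. *)
Lemma Rintegral_cube_le (h : 'rV[R]_m -> R) c r tau x : 0 <= c -> 0 < r -> H x ->
  measurable_fun Q (h : _ -> measurableTypeR R) ->
  (forall t, Q t -> `|h t| <= c * hyp_grad_norm f (flow r tau x t)) ->
  `|\int[leb]_(t in Q) h t| <= c * (average_const r tau * g).
Proof.
move=> c0 r0 x0 mh hb.
have mQ := @measurable_unit_cube R m.
have mg : measurable_fun Q ((fun t => hyp_grad_norm f (flow r tau x t)) : _ -> measurableTypeR R).
  apply: measurable_comp_cube; [exact: measurable_hyp_grad_norm|exact: measurable_flow|].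
  by move=> t _; exact: half_space_flow.
have B : (\int[leb]_(t in Q) `|(h t)%:E| <= (c * (average_const r tau * g))%:E)%E.
  apply: (@le_trans _ _ (\int[leb]_(t in Q) (c%:E * (hyp_grad_norm f (flow r tau x t))%:E))%E).
    apply: ge0_le_integral => //.
    - by apply: measurableT_comp => //; exact/measurable_EFinP.
    - by apply/measurable_EFinP; apply: measurable_funM.
  rewrite ge0_integralZl//; last 2 first.
  - exact/measurable_EFinP.
  - by move=> t _; rewrite lee_fin hyp_grad_norm_ge0.
  rewrite EFinM lee_wpmul2l ?lee_fin// EFinM -Gg.
  exact: cube_average_grad_le.
have ih : leb.-integrable Q (EFin \o h).
  by apply/integrableP; split; [exact/measurable_EFinP|exact: le_lt_trans B (ltry _)].
rewrite -lee_fin EFin_normr_Rintegral//.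
by apply: le_trans B; apply: le_abse_integral => //; exact/measurable_EFinP.
Qed.

Lemma average_const_le r : 0 < r -> n%:R * r <= n%:R ->
  average_const r 0 <= expR (n%:R / p) * r `^ (- (m%:R / p)).
Proof.
move=> r0 nr; rewrite /average_const subr0 powRM ?expR_ge0//; last first.
  by rewrite invr_ge0 exprn_ge0// ltW.
rewrite mulrC; apply: ler_pM; rewrite ?powR_ge0//.
  by rewrite [leRHS]expRM ge0_ler_powR ?nnegrE ?expR_ge0 ?invr_ge0 ?(ltW p0)// ler_expR.
by rewrite -powR_invn ?(ltW r0)// -powRrM mulNr.
Qed.

Lemma average_const1 tau : average_const 1 tau = expR (n%:R / p) * expR (- (n%:R / p) * tau).
Proof.
rewrite /average_const expr1n invr1 mul1r -expRM -expRD; congr expR; ring.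
Qed.

Lemma measurable_curve_derivative (gam dgam : 'rV[R]_m -> 'rV[R]_m) :
  measurable_fun setT gam -> (forall t, Q t -> H (gam t)) -> 
  (forall i, measurable_fun Q ((fun t => dgam t 0 i) : _ -> measurableTypeR R)) ->
  measurable_fun Q ((fun t => 1 * \sum_(i < m) partial i f (gam t) * dgam t 0 i) : _ -> measurableTypeR R).
Proof.
move=> mg Hg md; apply: measurable_funM => //.
apply: measurable_sum => i; apply: measurable_funM; last exact: md.
by apply: measurable_comp_cube => //; apply: test_function_measurable; exact: test_function_partial.
Qed.

(** A vector at y whose coordinates are at most y_m in absolute value has bounded
hyperbolic length, so the derivative of f along it is controlled by the gradient norm. *)
Lemma curve_derivative_le (y v : 'rV[R]_m) : H y -> (forall i, `|v 0 i| <= height y) ->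
  `|1 * \sum_(i < m) partial i f y * v 0 i| <= m%:R * hyp_grad_norm f y.
Proof.
move=> y0 vy; rewrite mul1r; apply: le_trans (ler_norm_sum _ _ _) _.
apply: (@le_trans _ _ (\sum_(i < m) hyp_grad_norm f y)).
  apply: ler_sum => i _; rewrite normrM mulrC.
  apply: le_trans (partial_le_grad_norm f i y0).
  by rewrite ler_wpM2r// vy.
by rewrite sumr_const card_ord -[leLHS]mulr_natl.
Qed.

Let w1 : @weight R n (fun=> 1).
Proof. by split => //; exists 1 => t _; rewrite normr1. Qed.

Lemma grad_avg_le r x : 0 < r -> n%:R * r <= n%:R -> H x ->
  hyp_grad_norm (avg r (fun=> 1) f) x <=
  m%:R * (m%:R * (expR (n%:R / p) * r `^ (- (m%:R / p)) * g)).
Proof.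
move=> r0 nr x0; have hx : 0 < height x by [].
apply: le_trans (grad_norm_le_partials _ x0) _.
apply: (@le_trans _ _ (\sum_(j < m) (m%:R * (expR (n%:R / p) * r `^ (- (m%:R / p)) * g)))); last first.
  by rewrite sumr_const card_ord -[leLHS]mulr_natl.
apply: ler_sum => j _.
have [_ E] := is_derive_avg r0 j w1 tf x0.
rewrite /partial E.
apply: (@le_trans _ _ (m%:R * (average_const r 0 * g))); last first.
  by rewrite ler_wpM2l// ler_wpM2r// average_const_le.
rewrite mulrC -ler_pdivlMr// mulrAC.
pose dg t : 'rV[R]_m := \row_i flow_jac r j i t.
have dgE : (fun t => 1 * \sum_(i < m) partial i f (flow r 0 x t) * flow_jac r j i t) =
    (fun t => 1 * \sum_(i < m) partial i f (flow r 0 x t) * dg t 0 i).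
  by apply/funext => t; congr (_ * _); apply: eq_bigr => i _; rewrite mxE.
apply: (@Rintegral_cube_le _ _ r 0 x) => //.
- by rewrite divr_ge0// ltW.
- suff : measurable_fun Q ((fun t => 1 * \sum_(i < m) partial i f (flow r 0 x t) * dg t 0 i) : _ -> measurableTypeR R).
    by rewrite -dgE.
  apply: measurable_curve_derivative.
  + exact: measurable_flow.
  + by move=> t _; exact: half_space_flow.
  + move=> i; apply: measurable_funTS; rewrite (_ : (fun _ => _) = flow_jac r j i).
      exact: measurable_flow_jac.
    by apply/funext => t; rewrite mxE.
move=> t Qt.
rewrite mulrAC ler_pdivlMr// mulrC -[X in X * _](gtr0_norm hx) -normrM.
rewrite (_ : height x * _ = 1 * \sum_(i < m) partial i f (flow r 0 x t) *
   (\row_i (height x * flow_jac r j i t)) 0 i); last first.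
  by rewrite !mul1r mulr_sumr; apply: eq_bigr => i _; rewrite mxE mulrCA.
apply: curve_derivative_le; first exact: half_space_flow.
move=> i; rewrite mxE normrM gtr0_norm//.
have rt0 : 0 <= r * height t by rewrite mulr_ge0 ?ltW//; case/andP: (Qt ord_max).
have ehx : height x <= height (flow r 0 x t).
  by rewrite height_flow ler_peMr ?(ltW hx)// subr0 -expR0 ler_expR.
rewrite /flow_jac; case: ifP => [_|jm]; last first.
  by apply: le_trans ehx; case: (i == j); rewrite ?normr1 ?normr0 ?mulr1 ?mulr0 ?(ltW hx)//.
case: eqP => [->|/eqP im].
  by rewrite ger0_norm ?expR_ge0// height_flow.
apply: le_trans ehx; rewrite ler_piMr ?(ltW hx)//.
have /andP[t0 t1] := Qt i.
rewrite ger0_norm ?mulr_ge0 ?(ltW r0) ?(ltW t0)//.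
have r1 : r <= 1.
  have n0 : (0 < n)%N.
    have := ltn_ord i; rewrite ltnS leq_eqVlt => /orP[/eqP e|]; last exact: leq_ltn_trans.
    by move: im; rewrite -val_eqE/= e eqxx.
  by rewrite -(ler_pM2l (_ : 0 < n%:R)) ?mulr1// ltr0n.
by rewrite mulr_ile1// ltW.
Qed.

Section along_r.
Variable x : 'rV[R]_m.
Hypothesis x0 : H x.

Let hx : 0 < height x. Proof. exact: x0. Qed.

(** The velocity of s |-> flow s 0 x t. *)
Let dr (s : R) t : 'rV[R]_m := \row_i (if i == ord_max
  then t 0 i * (height x * expR (t 0 i * s - 0)) else height x * t 0 i).

Let is_derive_flow_r s t i : is_derive s (1 : R) (fun s => flow s 0 x t 0 i) (dr s t 0 i).
Proof.
rewrite mxE.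
rewrite (_ : (fun _ => _) = (fun s => if i == ord_max then height x * expR (t 0 i * s - 0)
   else x 0 i + height x * t 0 i * s)); last first.
  apply/funext => s'; rewrite flowE /flow_coord; case: ifP => _; first by rewrite (mulrC s').
  by rewrite -mulrA (mulrC s').
by case: (i == ord_max); [exact: is_derive_expR_affine|exact: is_derive_affine].
Qed.

Let dr_le s t i : 0 <= s -> Q t -> `|dr s t 0 i| <= height (flow s 0 x t).
Proof.
move=> s0 Qt; have /andP[t0 t1] := Qt i; have /andP[tm0 tm1] := Qt ord_max.
have st0 : 0 <= s * height t by rewrite mulr_ge0// ltW.
have ehx : height x <= height (flow s 0 x t).
  by rewrite height_flow ler_peMr ?(ltW hx)// subr0 -expR0 ler_expR.
rewrite mxE; case: eqP => [->|_].
  rewrite ger0_norm; last by rewrite !mulr_ge0 ?expR_ge0 ?ltW.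
  rewrite height_flow [height t * s]mulrC ler_piMl//.
  by rewrite mulr_ge0 ?expR_ge0 ?ltW.
rewrite ger0_norm; last by rewrite mulr_ge0 ?ltW.
by apply: le_trans ehx; rewrite ler_piMr// ltW.
Qed.

Let dr_bound s s0 t i : s0 - 1 < s < s0 + 1 -> Q t ->
  `|dr s t 0 i| <= height x * expR (`|s0| + 1) + height x.
Proof.
move=> /andP[s1 s2] Qt; have /andP[t0 t1] := Qt i.
have e0 : 0 <= height x * expR (`|s0| + 1) by rewrite mulr_ge0 ?expR_ge0 ?ltW.
rewrite mxE; case: ifP => _; last first.
  rewrite ger0_norm; last by rewrite mulr_ge0 ?ltW.
  by apply: ler_wpDl => //; rewrite ler_piMr// ltW.
rewrite ger0_norm; last by rewrite !mulr_ge0 ?expR_ge0 ?ltW.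
apply: ler_wpDr; first exact: ltW.
apply: (@le_trans _ _ (height x * expR (t 0 i * s - 0))).
  by rewrite ler_piMl// mulr_ge0 ?expR_ge0 ?ltW.
rewrite ler_pM2l// ler_expR subr0.
have s3 : s <= `|s0| + 1 by apply: le_trans (ltW s2) _; rewrite lerD2r ler_norm.
apply: (@le_trans _ _ (t 0 i * (`|s0| + 1))); first by rewrite ler_wpM2l// ltW.
by rewrite ler_piMl// addr_ge0.
Qed.

Lemma is_derive_avg_r s0 : is_derive s0 (1 : R) (fun s => avg s (fun=> 1) f x)
  (\int[leb]_(t in Q) (1 * \sum_(i < m) partial i f (flow s0 0 x t) * dr s0 t 0 i)).
Proof.
apply: (@is_derive_integral_cube R n f (fun=> 1) (fun s t => flow s 0 x t) dr
  (s0 - 1) (s0 + 1) s0 (height x * expR (`|s0| + 1) + height x) tf w1).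
- by apply/andP; split; [rewrite ltrBlDr ltrDl|rewrite ltrDl].
- by move=> s _; exact: measurable_flow.
- by move=> s t _ _; exact: half_space_flow.
- by move=> s t i _ _; exact: is_derive_flow_r.
- by move=> s t i ss Qt; exact: dr_bound.
Qed.

(** The bound on the oscillation: Morrey's inequality. *)
Lemma avg_dist_le r : 0 < r -> n%:R * r <= n%:R ->
  `|f x - avg r (fun=> 1) f x| <=
  m%:R * (expR (n%:R / p) * g) / (1 - m%:R / p) * r `^ (1 - m%:R / p).
Proof.
move=> r0 nr.
pose a : R := 1 - m%:R / p; pose k := m%:R * (expR (n%:R / p) * g).
have a0 : 0 < a by rewrite subr_gt0 ltr_pdivrMr// mul1r.
have k0 : 0 <= k by rewrite !mulr_ge0 ?expR_ge0.
pose F s := avg s (fun=> 1) f x.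
pose K s := k / a * s `^ a.
have F0 : F 0 = f x.
  rewrite /F /avg -[RHS](@Rintegral_cube_cst R n); apply: eq_Rintegral => t _.
  by rewrite mul1r flow0.
have step e : 0 < e -> e <= r -> `|F r - F e| <= K r.
  move=> e0 er; apply: (@le_trans _ _ (K r - K e)); last first.
    by rewrite gerBl mulr_ge0 ?powR_ge0// divr_ge0// ltW.
  apply: (@ler_dist_derive _ F K _ (fun s => k * s `^ (a - 1)) e r er
    (fun s _ => is_derive_avg_r s)).
    move=> s /andP[es sr].
    have := is_deriveZ (k / a) (is_derive1_powR a (lt_le_trans e0 es)).
    move=> D; apply: (is_derive_eq D).
    by rewrite -[LHS]/(k / a * (a * s `^ (a - 1))) mulrA divfK// gt_eqF.
  move=> s /andP[es sr]; have s0 : 0 < s by exact: lt_le_trans es.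
  have ns : n%:R * s <= n%:R by apply: le_trans nr; rewrite ler_wpM2l.
  apply: (@le_trans _ _ (m%:R * (average_const s 0 * g))).
    apply: (@Rintegral_cube_le _ _ s 0 x) => //.
      apply: measurable_curve_derivative.
      - exact: measurable_flow.
      - by move=> t _; exact: half_space_flow.
      - move=> i; apply: measurable_funTS.
        have mt : measurable_fun setT ((fun t : 'rV[R]_m => t 0 i) : _ -> measurableTypeR R).
          exact: (@measurable_coord _ (measurableTypeR R) 1 m ord0 i).
        rewrite (_ : (fun _ => _) = fun t => if i == ord_max
            then t 0 i * (height x * expR (t 0 i * s - 0)) else height x * t 0 i); last first.
          by apply/funext => t; rewrite mxE.
        case: (i == ord_max); last exact: measurable_funM.
        apply: measurable_funM => //; apply: measurable_funM => //.
        apply: (measurableT_comp (@measurable_expR R)).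
        by apply: measurable_funB => //; exact: measurable_funM.
    move=> t Qt; apply: curve_derivative_le; first exact: half_space_flow.
    by move=> i; apply: dr_le => //; exact: ltW.
  rewrite /k (_ : a - 1 = - (m%:R / p)); last by rewrite /a; ring.
  rewrite -!mulrA ler_wpM2l// [g * _]mulrC mulrA ler_wpM2r//.
  exact: average_const_le.
rewrite -F0 distrC; apply/ler_addgt0Pr => e e0.
have cF : F s @[s --> 0] --> F 0 := is_derive_continuous (is_derive_avg_r 0).
have [d /= d0 dF] := (cvgrPdist_le _ _).1 cF e e0.
(* s `^ (a - 1) is singular at 0: the comparison is made on [e1, r], and A_s f (x)
   is continuous at s = 0 *)
pose e1 := Num.min r (d / 2).
have e10 : 0 < e1 by rewrite lt_min r0 divr_gt0.
have e1d : `|0 - e1| < d.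
  rewrite sub0r normrN gtr0_norm// /e1 gt_min; apply/orP; right.
  by rewrite ltr_pdivrMr// ltr_pMr// ltr1n.
have e1r : e1 <= r by rewrite /e1 ge_min lexx.
have h1 := step e1 e10 e1r.
have h2 := dF e1 e1d.
rewrite -[X in `|X|](subrKA (F e1)).
apply: le_trans (ler_normD _ _) _; apply: lerD => //.
by rewrite distrC.
Qed.

End along_r.

Section along_tau.
Variable x : 'rV[R]_m.
Hypothesis x0 : H x.

Let hx : 0 < height x. Proof. exact: x0. Qed.

(** The velocity of tau |-> flow 1 tau x t, which is vertical. *)
Let dt (s : R) t : 'rV[R]_m := \row_i (if i == ord_max
  then - height (flow 1 s x t) else 0).

Let is_derive_flow_tau s t i : is_derive s (1 : R) (fun s => flow 1 s x t 0 i) (dt s t 0 i).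
Proof.
rewrite mxE.
rewrite (_ : (fun _ => _) = (fun s => if i == ord_max then height x * expR (-1 * s - - t 0 i)
   else x 0 i + height x * t 0 i)); last first.
  apply/funext => s'; rewrite flowE /flow_coord !mul1r; case: ifP => _ //.
  by rewrite opprK mulN1r addrC.
case: eqP => [->|_].
  apply: (is_derive_eq (is_derive_expR_affine (height x) (-1) (- t 0 ord_max) s)).
  by rewrite height_flow mulN1r opprK mulN1r mul1r addrC.
exact: is_derive_cst.
Qed.

Let F (tau : R) := \int[leb]_(t in Q) (1 * f (flow 1 tau x t)).

Lemma is_derive_avg_tau s0 : is_derive s0 (1 : R) F
  (\int[leb]_(t in Q) (1 * \sum_(i < m) partial i f (flow 1 s0 x t) * dt s0 t 0 i)).
Proof.
apply: (@is_derive_integral_cube R n f (fun=> 1) (fun s t => flow 1 s x t) dt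
  (s0 - 1) (s0 + 1) s0 (height x * expR (2 - s0)) tf w1).
- by apply/andP; split; [rewrite ltrBlDr ltrDl|rewrite ltrDl].
- by move=> s _; exact: measurable_flow.
- by move=> s t _ _; exact: half_space_flow.
- by move=> s t i _ _; exact: is_derive_flow_tau.
- move=> s t i /andP[s1 s2] Qt; rewrite mxE.
  case: ifP => _; last by rewrite normr0 mulr_ge0 ?expR_ge0 ?ltW.
  rewrite normrN height_flow ger0_norm; last by rewrite mulr_ge0 ?expR_ge0 ?ltW.
  rewrite ler_pM2l// ler_expR mul1r.
  have /andP[_ t1] := Qt ord_max; rewrite /height; lra.
Qed.

(** For n > 0 the average over a unit cube is controlled by the gradient alone,
by moving the cube down until it leaves the support of f. *)
Lemma avg1_le : (0 < n)%N ->
  `|avg 1 (fun=> 1) f x| <= p / n%:R * (m%:R * (expR (n%:R / p) * g)).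
Proof.
move=> n0; pose b : R := n%:R / p; pose k := m%:R * (expR b * g).
have b0 : 0 < b by rewrite divr_gt0// ltr0n.
have k0 : 0 <= k by rewrite !mulr_ge0 ?expR_ge0.
have -> : p / n%:R * k = k / b by rewrite /b invf_div mulrC.
have [_ [delta [rho [d0 bf]]]] := tf.
pose T := 1 + `|ln (delta / (2 * height x))|.
have T0 : 0 <= T by rewrite addr_ge0.
(* T is large enough for the translated cube to lie below height delta / 2 *)
have FT : F T = 0.
  rewrite /F (@eq_Rintegral _ _ _ leb Q (cst 0)).
    by rewrite /Rintegral integral0.
  move=> t; rewrite inE => Qt; rewrite mul1r; apply/eqP/negPn/negP => ft.
  have [h1 _] := bf _ (half_space_flow 1 T t x0) ft.
  have /andP[_ t1] := Qt ord_max.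
  have : height (flow 1 T x t) <= delta / 2.
    rewrite height_flow mul1r (_ : delta / 2 = height x * (delta / (2 * height x))); last first.
      by field; rewrite gt_eqF.
    rewrite ler_pM2l// -[leRHS]lnK ?posrE ?divr_gt0 ?mulr_gt0// ler_expR.
    apply: (@le_trans _ _ (- `|ln (delta / (2 * height x))|)); last first.
      by rewrite lerNl -normrN ler_norm.
    rewrite /T opprD addrA gerDr; rewrite subr_le0; exact: t1.
  rewrite leNgt => /negP; apply; apply: lt_le_trans h1.
  by rewrite ltr_pdivrMr// ltr_pMr// ltr1n.
pose K s := - (k / b) * expR (- b * s - 0).
have : `|F T - F 0| <= K T - K 0.
  apply: (@ler_dist_derive _ F K _ (fun s => k * expR (- b * s)) 0 T T0
    (fun s _ => is_derive_avg_tau s)).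
    move=> s _; apply: (is_derive_eq (is_derive_expR_affine (- (k / b)) (- b) 0 s)).
    by rewrite subr0; field; rewrite gt_eqF.
  move=> s /andP[s0 _].
  apply: (@le_trans _ _ (m%:R * (average_const 1 s * g))).
    apply: (@Rintegral_cube_le _ _ 1 s x) => //.
      apply: measurable_curve_derivative.
      - exact: measurable_flow.
      - by move=> t _; exact: half_space_flow.
      - move=> i; apply: measurable_funTS.
        rewrite (_ : (fun _ => _) = fun t => if i == ord_max
            then - height (flow 1 s x t) else 0); last first.
          by apply/funext => t; rewrite mxE.
        case: (i == ord_max) => //.
        apply: measurableT_comp => //.
        by apply: (measurableT_comp (@measurable_height R n)); exact: measurable_flow.
    move=> t Qt; apply: curve_derivative_le; first exact: half_space_flow.
    move=> i; rewrite mxE; case: ifP => _.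
      by rewrite normrN gtr0_norm//; exact: half_space_flow.
    by rewrite normr0 ltW//; exact: half_space_flow.
  by rewrite average_const1 /k -/b -!mulrA [g * _]mulrC.
rewrite FT sub0r normrN -/(F 0) => /le_trans; apply.
rewrite /K !subr0 mulr0 expR0 mulr1 opprK mulNr gerDr oppr_le0.
by rewrite mulr_ge0 ?expR_ge0// divr_ge0// ltW.
Qed.

End along_tau.

End bounds.

(** * The decomposition *)

Lemma smooth_compact_hyp0 (R : realType) (n : nat) :
  smooth_compact_hyp (fun _ : 'rV[R]_n.+1 => 0).
Proof.
apply: box_smooth_compact.
  by apply: (avg_span_smooth (@ltr01 R)); apply: Span0.
by exists 1, 0; split => // x _; rewrite eqxx.
Qed.

Lemma hyp_grad_norm0 (R : realType) (n : nat) (x : 'rV[R]_n.+1) : half_space x ->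
  hyp_grad_norm (fun=> 0) x = 0.
Proof.
move=> x0; apply/eqP; rewrite eq_le hyp_grad_norm_ge0 andbT.
apply: le_trans (grad_norm_le_partials _ x0) _.
rewrite big1// => i _; rewrite /partial (_ : (fun=> 0) = cst 0)//.
by rewrite derive_cst normr0 mulr0.
Qed.

(* The dimension is m = n.+1. *)
Theorem lemma10 (R : realType) (n : nat) (p : R) (hp : n.+1%:R < p) :
  exists C : R,
  forall (phi : 'rV[R]_n.+1 -> R) (lambda : R),
  smooth_compact_hyp phi -> 0 < lambda ->
  exists phi1 phi2 : 'rV[R]_n.+1 -> R,
  [/\ forall x, half_space x -> phi x = phi1 x + phi2 x,
      smooth_compact_hyp phi2,
      (Lnorm_hyp +oo phi1 <=
        (C * lambda `^ (1 - n.+1%:R / p))%:E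
          * Lnorm_hyp p%:E (hyp_grad_norm phi))%E
    & (Lnorm_hyp +oo (hyp_grad_norm phi2) <=
        (C * lambda `^ (- (n.+1%:R / p)))%:E
          * Lnorm_hyp p%:E (hyp_grad_norm phi))%E].
Proof.
have p0 : 0 < p by apply: lt_trans hp; rewrite ltr0n.
pose E := expR (n%:R / p); pose a : R := 1 - n.+1%:R / p.
have E0 : 0 < E by exact: expR_gt0.
have a0 : 0 < a by rewrite subr_gt0 ltr_pdivrMr// mul1r.
pose C1 := n.+1%:R * (n.+1%:R * E); pose C2 := n.+1%:R * E / a.
pose C3 := p / n%:R * (n.+1%:R * E).
have C10 : 0 < C1 by rewrite !mulr_gt0.
have C20 : 0 < C2 by rewrite divr_gt0// mulr_gt0.
have C30 : 0 <= C3 by rewrite !mulr_ge0 ?invr_ge0 ?(ltW p0) ?(ltW E0)//.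
have Cp : 0 < C1 + C2 + C3 by exact: ltr_wpDr C30 (addr_gt0 C10 C20).
(* C1 bounds the gradient of the average, C2 the oscillation and C3 the average
   over a unit cube *)
exists (C1 + C2 + C3) => phi lambda sphi l0.
have tphi : test_function phi by split; [case: sphi|exact: smooth_compact_box].
(* if the L^p norm is infinite both bounds are trivial *)
have [Goo|Gfin] := eqVneq (Lnorm_hyp p%:E (hyp_grad_norm phi)) +oo%E.
  exists (fun=> 0), phi; split => //; first by move=> x _; rewrite add0r.
    by rewrite Goo gt0_muley ?leey// lte_fin mulr_gt0 ?powR_gt0.
  by rewrite Goo gt0_muley ?leey// lte_fin mulr_gt0 ?powR_gt0.
have G0 : (0 <= Lnorm_hyp p%:E (hyp_grad_norm phi))%E by exact: Lnorm_ge0.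
have [g Gg] : exists g, Lnorm_hyp p%:E (hyp_grad_norm phi) = g%:E.
  by move: G0 Gfin; case: (Lnorm_hyp _ _) => // g _ _; exists g.
have g0 : 0 <= g by rewrite -lee_fin -Gg.
(* lambda <= 1 or n = 0 *)
have [nl|nl] := leP (n%:R * lambda) n%:R.
  pose phi2 := avg lambda (fun=> 1) phi.
  exists (fun x => phi x - phi2 x), phi2; split.
  - by move=> x _; rewrite subrK.
  - by have [] := avg_test_function l0 tphi; exact: box_smooth_compact.
  - rewrite Gg -EFinM; apply: le_Lnorm_hypy.
      by rewrite !mulr_ge0 ?powR_ge0 ?(ltW Cp).
    move=> x x0; apply: le_trans (avg_dist_le hp tphi Gg x0 l0 nl) _.
    rewrite -/a -/E [leLHS](_ : _ = C2 * lambda `^ a * g); last by rewrite /C2; ring.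
    by rewrite !ler_wpM2r ?powR_ge0// -addrA addrCA lerDl addr_ge0// ltW.
  - rewrite Gg -EFinM; apply: le_Lnorm_hypy.
      by rewrite !mulr_ge0 ?powR_ge0 ?(ltW Cp).
    move=> x x0; rewrite ger0_norm ?hyp_grad_norm_ge0//.
    apply: le_trans (grad_avg_le hp tphi Gg l0 nl x0) _.
    rewrite -/E [leLHS](_ : _ = C1 * lambda `^ (- (n.+1%:R / p)) * g); last by rewrite /C1; ring.
    by rewrite !ler_wpM2r ?powR_ge0// -addrA lerDl addr_ge0// ltW.
have n0 : (0 < n)%N by case: (n) nl => //; rewrite mul0r ltxx.
have l1 : 1 < lambda by move: nl; rewrite -[ltLHS]mulr1 ltr_pM2l// ltr0n.
exists phi, (fun=> 0); split.
- by move=> x _; rewrite addr0.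
- exact: smooth_compact_hyp0.
- rewrite Gg -EFinM; apply: le_Lnorm_hypy.
    by rewrite !mulr_ge0 ?powR_ge0 ?(ltW Cp).
  move=> x x0.
  have n1 : n%:R * 1 <= n%:R :> R by rewrite mulr1.
  have h1 := avg_dist_le hp tphi Gg x0 ltr01 n1.
  have h2 := avg1_le hp tphi Gg x0 n0.
  rewrite -[phi x](subrK (avg 1 (fun=> 1) phi x)).
  apply: le_trans (ler_normD _ _) _.
  apply: le_trans (lerD h1 h2) _; rewrite powR1 mulr1 -/a -/E.
  rewrite [leLHS](_ : _ = (C2 + C3) * g); last by rewrite /C2 /C3; ring.
  rewrite ler_wpM2r//; apply: (@le_trans _ _ (C1 + C2 + C3)); first by rewrite -addrA lerDr ltW.
  rewrite ler_peMr ?(ltW Cp)// -(powRr0 lambda).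
  by apply: ler_powR; exact: ltW.
- rewrite Gg -EFinM; apply: le_Lnorm_hypy.
    by rewrite !mulr_ge0 ?powR_ge0 ?(ltW Cp).
  move=> x x0; rewrite hyp_grad_norm0// normr0.
  by rewrite !mulr_ge0 ?powR_ge0 ?(ltW Cp).
Qed.
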